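(* Let $G$ be a Helly $EPT$ graph and let $h\geq 3$ be an integer. Then $G\notin$ Helly $[h,2,2]$ if and only if there exists an integer $k>h$ such that $G$ has a $k$-gate as an induced subgraph.
   Context: All graphs are finite and simple. An $EPT$ representation of a graph $G$ is a pair $\langle \mathcal{P},T\rangle$ where $T$ is a tree (the host tree) and $\mathcal{P}=(P_v)_{v\in V(G)}$ is a family of subpaths of $T$ such that two distinct vertices $v,w$ of $G$ are adjacent if and only if $E(P_v)\cap E(P_w)\neq\emptyset$. $G$ is $EPT$ if it has such a representation. If the host tree has maximum degree $h$, the representation is an $(h,2,2)$-representation; $[h,2,2]$ is the class of graphs admitting an $(h,2,2)$-representation. A representation is Helly if the family $(E(P))_{P\in\mathcal{P}}$ has the Helly property (every pairwise intersecting subfamily has nonempty total intersection). $G$ is Helly $EPT$ if it has a Helly $EPT$ representation, and $G\in$ Helly $[h,2,2]$ if it has a Helly $(h,2,2)$-representation. A clique is a maximal complete set of vertices. Gates are defined recursively: (i) every chordless cycle $C_n$ with $n\geq 4$ is a gate; (ii) if $H$ is a gate, $C$ and $C'$ are disjoint cliques of $H$, and $P=(v_1,\dots,v_l)$ with $l\geq 2$ is a chordless path vertex-disjoint from $H$, then the graph consisting of the union of $H$ and $P$ together with all edges between $v_1$ and the vertices of $C$ and all edges between $v_l$ and the vertices of $C'$ is a gate; (iii) there are no other gates. A gate with exactly $k$ cliques is called a $k$-gate. *)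

(* Defs.v *)
From mathcomp Require Import all_boot.
Set Implicit Arguments.
Unset Strict Implicit.
Unset Printing Implicit Defensive.

Definition is_tree (T : finType) (e : rel T) : Prop :=
  [/\ symmetric e, irreflexive e, 0 < #|T|,
      (forall x y, connect e x y) &
      ~ (exists c : seq T, [/\ uniq c, 3 <= size c & cycle e c])].

Definition max_degree (T : finType) (e : rel T) : nat :=
  \max_(x : T) #|[set y | e x y]|.

Definition is_tree_path (T : finType) (e : rel T) (p : seq T) : Prop :=
  match p with
  | [::] => False
  | x :: q => [/\ q != [::], uniq p & path e x q]
  end.

Definition path_edges (T : finType) (p : seq T) : {set {set T}} :=
  [set [set u.1; u.2] | u in zip p (behead p)].

Definition EPT_rep (V : finType) (adj : rel V)
    (T : finType) (e : rel T) (P : V -> seq T) : Prop :=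
  [/\ is_tree e,
      (forall v, is_tree_path e (P v)) &
      (forall v w, v != w ->
         adj v w <-> path_edges (P v) :&: path_edges (P w) != set0)].

Definition Helly_rep (V : finType) (T : finType) (P : V -> seq T) : Prop :=
  forall S : {set V},
    (forall v w, v \in S -> w \in S ->
       path_edges (P v) :&: path_edges (P w) != set0) ->
    \bigcap_(v in S) path_edges (P v) != set0.

Definition Helly_EPT (V : finType) (adj : rel V) : Prop :=
  exists (T : finType) (e : rel T) (P : V -> seq T),
    EPT_rep adj e P /\ Helly_rep P.

Definition Helly_h22 (V : finType) (adj : rel V) (h : nat) : Prop :=
  exists (T : finType) (e : rel T) (P : V -> seq T),
    [/\ EPT_rep adj e P, max_degree e = h & Helly_rep P].

Definition is_clique_in (V : finType) (adj : rel V) (S K : {set V}) : bool :=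
  [&& K \subset S,
      [forall x in K, forall y in K, (x != y) ==> adj x y] &
      [forall x in S :\: K, exists y in K, ~~ adj x y]].

Definition num_cliques (V : finType) (adj : rel V) (S : {set V}) : nat :=
  #|[set K : {set V} | is_clique_in adj S K]|.

Definition induces_cycle (V : finType) (adj : rel V) (c : seq V) : Prop :=
  forall x y, x \in c -> y \in c ->
    adj x y = (y == next c x) || (x == next c y).

Definition induces_path (V : finType) (adj : rel V) (p : seq V) : Prop :=
  forall x y, x \in p -> y \in p ->
    adj x y = (index y p == (index x p).+1) || (index x p == (index y p).+1).

(* is_gate adj S : the subgraph of G induced by S is a gate
   (recursive definition of gates, transported to induced subgraphs) *)
Inductive is_gate (V : finType) (adj : rel V) : {set V} -> Prop :=
| gate_cycle (c : seq V) :
    uniq c -> 4 <= size c -> induces_cycle adj c ->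
    is_gate adj [set x in c]
| gate_ext (S0 C C' : {set V}) (v1 : V) (q : seq V) :
    is_gate adj S0 ->
    is_clique_in adj S0 C -> is_clique_in adj S0 C' -> [disjoint C & C'] ->
    q != [::] -> uniq (v1 :: q) -> induces_path adj (v1 :: q) ->
    (forall x, x \in v1 :: q -> x \notin S0) ->
    (forall x y, x \in v1 :: q -> y \in S0 ->
       adj x y = ((x == v1) && (y \in C)) || ((x == last v1 q) && (y \in C'))) ->
    is_gate adj (S0 :|: [set x in v1 :: q]).

(* Main.v *)
(** A path of a tree contains an edge exactly when that edge separates its two
    ends, so a representation amounts to a tree together with two ends for each
    vertex of the graph.

    A gate S stays connected after the removal of any complete set and is not
    itself complete.  Hence every edge f of the host tree has one side that
    contains all the paths of S avoiding f; orienting each edge towards that side,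
    some node x is a sink, and then every path of S uses an edge at x.  By the
    Helly property each clique of S is the set of paths through some edge at x, so
    x has degree at least the number of cliques.

    Conversely let x have degree d > h, and consider the graph W on the d edges at
    x in which each path passing through x joins the two edges that it uses.  If W
    is not 2-connected, then x can be split into two adjacent nodes so that the sum
    of the truncated differences deg - 3 decreases.  If W is 2-connected, take a
    minimal 2-connected spanning set of edges of W.  It has no parallel edges, no
    triangles and no chord of an ear, so its ears can be added one after the other
    to a cycle of length at least 4, always between non-adjacent vertices.  On the
    line graph, that is among the paths, each ear is one step of the construction
    of gates, and the cliques of the resulting gate are the d stars. *)

Require Import Defs.
From mathcomp Require Import all_boot zify.
Set Implicit Arguments.
Unset Strict Implicit.
Unset Printing Implicit Defensive.

(** * Sides of the edges of a tree *)

Lemma eq_set2 (T : finType) (u w s t : T) :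
  ([set u; w] == [set s; t]) = (u == s) && (w == t) || (u == t) && (w == s).
Proof.
apply/eqP/idP => [eq_uw|/orP[]/andP[/eqP-> /eqP->] //]; last by rewrite setUC.
move/setP: eq_uw => eq_uw; move: (eq_uw u) (eq_uw w) (eq_uw s) (eq_uw t).
rewrite !inE !eqxx !orbT (eq_sym s) (eq_sym s w) (eq_sym t) (eq_sym t w).
by do 6?case: (_ == _).
Qed.

Section Tree.
Variables (T : finType) (e : rel T).

Definition cut (s t : T) : rel T :=
  fun u w => e u w && ([set u; w] != [set s; t]).

Definition side (s t : T) : {set T} := locked [set z | connect (cut s t) t z].

Lemma in_side s t z : (z \in side s t) = connect (cut s t) t z.
Proof. by rewrite /side -lock inE. Qed.

(** A description of the side of an edge that avoids connectivity: a set left by a single edge, from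
    [t] to [s]. Sides of new trees can then be exhibited explicitly. *)
Definition is_side (s t : T) (Z : {set T}) : Prop :=
  [/\ t \in Z, s \notin Z &
      forall u w, e u w -> u \in Z -> w \notin Z -> u = t /\ w = s].

Lemma connect_ind (r : rel T) (Y : pred T) x z :
  (forall u w, r u w -> u \in Y -> w \in Y) ->
  connect r x z -> x \in Y -> z \in Y.
Proof.
move=> clY /connectP[p pth ->] {z}; elim: p x pth => //= y p IHp x /andP[rxy pth] Yx.
exact: IHp pth (clY _ _ rxy Yx).
Qed.

Hypotheses (esym : symmetric e) (econn : forall x y, connect e x y).

Lemma closed_set0 (Y : {set T}) x :
  (forall u w, e u w -> u \in Y -> w \in Y) -> x \notin Y -> Y = set0.
Proof.
move=> clY xY; apply/setP=> z; rewrite inE; apply: contraNF xY.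
by apply: (connect_ind (Y := mem Y)) (econn z x).
Qed.

(** The part of [Z] not reached from [t] is closed under adjacency, since the only exit of [Z] is at
    [t]; it misses [s], so by connectedness it is empty. *)
Lemma is_sideE s t Z : is_side s t Z -> side s t = Z.
Proof.
case=> tZ sZ crossZ; apply/eqP; rewrite eqEsubset -[Z \subset _]setD_eq0.
apply/andP; split; last first.
  apply/eqP; apply: (@closed_set0 _ s); last by rewrite !inE (negPf sZ) andbF.
  move=> u w euw; rewrite !inE !in_side => /andP[ntu Zu].
  have ut : u != t by apply: contraNneq ntu => ->; exact: connect0.
  have Zw : w \in Z by apply: contraNT ut => Zw; case: (crossZ u w) => // ->.
  rewrite Zw andbT; apply: contraNN ntu => /connect_trans; apply.
  apply: connect1; rewrite /cut esym euw eq_set2 (negPf ut) andbF /=.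
  by apply: contraNN sZ => /andP[_ /eqP <-].
apply/subsetP=> z; rewrite in_side => tz.
apply: (connect_ind (Y := mem Z)) tz tZ => u w /andP[euw nst] Zu.
apply: contraNT nst => Zw; have [-> ->] := crossZ u w euw Zu Zw.
by rewrite setUC.
Qed.

Lemma is_sideC s t Z : is_side s t Z -> is_side t s (~: Z).
Proof.
case=> tZ sZ crossZ; split; rewrite ?inE ?negbK //.
move=> u w euw; rewrite !inE negbK => Zu Zw.
by have [] := crossZ w u; rewrite // esym.
Qed.

(** Take the side of the first edge [s t] of the cycle. It can be left only at [t], which the cycle
    does not visit again, so the cycle cannot return to [s]. *)
Lemma is_side_acyclic c :
  (forall s t, e s t -> exists Z, is_side s t Z) ->
  ~ [/\ uniq c, 3 <= size c & cycle e c].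
Proof.
move=> sidesP [].
case: c => [|s [|t [|z c]]] //= /and4P[s_c t_c _ _] _ /and3P[est etz pth].
have [Z [tZ sZ crossZ]] := sidesP _ _ est.
have Zz : z \in Z.
  apply: contraNT s_c => Zz; case: (crossZ t z) => // _ <-; by rewrite !inE eqxx orbT.
elim: c z {etz s_c} t_c Zz pth => [|z' c IH] z /=;
  rewrite in_cons negb_or => /andP[tz tc] Zz /andP[ezz' pth].
  by have [zt] := crossZ _ _ ezz' Zz sZ; rewrite zt eqxx in tz.
have Zz' : z' \in Z.
  by apply: contraNT tz => Zz'; have [->] := crossZ _ _ ezz' Zz Zz'.
exact: IH tc Zz' pth.
Qed.
End Tree.

(** Stated by sides rather than by forbidding cycles: when a node is split, the new sides are
    computed from the old ones. *)
Definition tree (T : finType) (e : rel T) : Prop :=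
  [/\ symmetric e, forall x y, connect e x y &
      forall s t, e s t -> is_side e s t (side e s t)].

Lemma is_tree_tree (T : finType) (e : rel T) : is_tree e -> tree e.
Proof.
case=> esym eirr _ econn acyc; split=> // s t est; split.
- by rewrite in_side connect0.
- rewrite in_side; apply/negP=> /connectP[p pth def_s].
  (* A simple path from [t] to [s] that avoids the edge closes up with it into a cycle; it has an
     inner node because the edge itself is forbidden. *)
  case/shortenP: pth def_s => q pth uq _ def_s; apply: acyc.
  have pe : path e t q by apply: sub_path pth => u w /andP[].
  exists (t :: q); split=> //.
  + case: q pth uq def_s {pe} => [|z [|z' q]] //=.
      by move=> _ _ st; rewrite st eirr in est.
    by move=> /andP[/andP[_ +] _] _ sz; rewrite -sz setUC eqxx.
  + by rewrite /= rcons_path pe -def_s.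
- move=> u w euw; rewrite !in_side => tu ntw.
  have /eqP : [set u; w] == [set s; t].
    apply: contraNT ntw => nst; apply: connect_trans tu _.
    by apply: connect1; rewrite /cut euw.
  move/eqP; rewrite eq_set2 => /orP[]/andP[/eqP us /eqP wt] //.
  by rewrite wt connect0 in ntw.
Qed.

Lemma tree_is_tree (T : finType) (e : rel T) :
  0 < #|T| -> tree e -> is_tree e.
Proof.
move=> T0 [esym econn sidesP]; split=> // [x|[c]].
  by apply/negP=> /sidesP[-> ].
by apply: (is_side_acyclic (e := e)) => s t /sidesP; exists (side e s t).
Qed.

Lemma side_tree (T : finType) (e : rel T) :
  symmetric e -> (forall x y, connect e x y) ->
  (forall s t, e s t -> exists Z, is_side e s t Z) -> tree e.
Proof.
by move=> esym econn sidesP; split=> // s t /sidesP[Z ZP]; rewrite (is_sideE _ _ ZP).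
Qed.

Section TreeTheory.
Variables (T : finType) (e : rel T).
Hypothesis etree : tree e.

Let esym : symmetric e. Proof. by case: etree. Qed.
Let econn : forall x y, connect e x y. Proof. by case: etree. Qed.

Lemma sideP s t : e s t -> is_side e s t (side e s t).
Proof. by case: etree => _ _; apply. Qed.

Lemma side_in s t : e s t -> t \in side e s t.
Proof. by case/sideP. Qed.

Lemma side_notin s t : e s t -> s \notin side e s t.
Proof. by case/sideP. Qed.

Lemma side_cross s t u w : e s t -> e u w ->
  u \in side e s t -> w \notin side e s t -> u = t /\ w = s.
Proof. by case/sideP=> _ _ H; apply: H. Qed.

Lemma sideC s t : e s t -> side e t s = ~: side e s t.
Proof. by move=> /sideP est; apply: (is_sideE esym econn); apply: is_sideC. Qed.

Lemma tree_irr x : e x x = false.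
Proof. by apply/negP=> exx; have:= side_notin exx; rewrite side_in. Qed.

Lemma edge_side s t u w : e s t -> e u w -> [set u; w] != [set s; t] ->
  (u \in side e s t) = (w \in side e s t).
Proof.
move=> est euw; rewrite eq_set2 => nst; apply/idP/idP => [uZ|wZ].
  apply: contraNT nst => wZ; have [-> ->] := side_cross est euw uZ wZ.
  by rewrite !eqxx orbT.
rewrite esym in euw.
apply: contraNT nst => uZ; have [-> ->] := side_cross est euw wZ uZ.
by rewrite !eqxx.
Qed.

Lemma nbr_side x y w : e x y -> e x w -> (w \in side e x y) = (w == y).
Proof.
move=> exy exw; apply/idP/eqP => [wZ|->]; last exact: side_in.
by rewrite esym in exw; case: (side_cross exy exw wZ (side_notin exy)).
Qed.

(** The two branches can be left only through [y] and [y'], and neither of these lies in the other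
    branch; so the intersection is closed under adjacency and misses [x]. *)
Lemma side_disjoint x y y' z : e x y -> e x y' ->
  z \in side e x y -> z \in side e x y' -> y = y'.
Proof.
move=> exy exy' zy zy'; apply/eqP; apply: contraTT zy => nyy'.
suff /setP/(_ z) : side e x y :&: side e x y' = set0 by rewrite !inE zy' andbT => ->.
apply: (closed_set0 econn) (x) _ _ => [u w euw|]; last by rewrite inE (negPf (side_notin exy)).
rewrite !inE => /andP[uy uy']; apply/andP; split; apply: contraTT isT => wy.
  have [uy0 _] := side_cross exy euw uy wy.
  by rewrite uy0 nbr_side // (negPf nyy') in uy'.
have [uy0 _] := side_cross exy' euw uy' wy.
by rewrite uy0 nbr_side // eq_sym (negPf nyy') in uy.
Qed.

Lemma side_cover x z : z != x -> exists2 y, e x y & z \in side e x y.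
Proof.
move=> zx; pose U := [set z | (z == x) || [exists y, e x y && (z \in side e x y)]].
have clU u w : e u w -> u \in U -> w \in U.
  move=> euw; rewrite !inE => /orP[/eqP ux|/existsP[y /andP[exy uy]]].
    by apply/orP; right; apply/existsP; exists w; rewrite -ux euw side_in.
  have [wy|wy] := boolP (w \in side e x y).
    by apply/orP; right; apply/existsP; exists y; rewrite exy.
  by have [_ ->] := side_cross exy euw uy wy; rewrite eqxx.
have : z \in U by apply: (connect_ind (Y := mem U)) (econn x z) _ => //; rewrite !inE eqxx.
by rewrite inE (negPf zx) => /existsP[y /andP[]]; exists y.
Qed.

(** An edge with both ends outside a side is not met when moving inside it. Hence the nodes of the
    side that [s' t'] separates from [t] form a closed set missing [s]. *)
Lemma side_laminar s t s' t' z z' : e s t -> e s' t' ->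
  s' \notin side e s t -> t' \notin side e s t ->
  z \in side e s t -> z' \in side e s t ->
  (z \in side e s' t') = (z' \in side e s' t').
Proof.
move=> est est' s'Z t'Z.
suff H w : w \in side e s t -> (w \in side e s' t') = (t \in side e s' t').
  by move=> /H-> /H->.
pose Y := [set w in side e s t | (w \in side e s' t') != (t \in side e s' t')].
suff : Y = set0 by move=> /setP/(_ w) + wZ; rewrite !inE wZ => /negbFE/eqP.
apply: (closed_set0 econn) (s) _ _ => [u v euv|]; last by rewrite inE (negPf (side_notin est)).
rewrite !inE => /andP[uZ ne].
have vZ : v \in side e s t.
  apply: contraNT ne => vZ; have [-> _] := side_cross est euv uZ vZ; by rewrite eqxx.
rewrite vZ -(edge_side est' euv) // eq_set2 negb_or !negb_and.
by apply/andP; split; apply/orP; left; apply: contraTneq uZ => ->.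
Qed.

Lemma side_sub_branch x y s t : e x y -> e s t ->
  x \notin side e s t -> t \in side e x y -> side e s t \subset side e x y.
Proof.
move=> exy est xZ ty; rewrite -setD_eq0; apply/eqP.
apply: (closed_set0 econn) (x) _ _ => [u w euw|]; last by rewrite inE (negPf xZ) andbF.
rewrite !inE => /andP[uy uZ]; apply/andP; split.
  apply: contraNN xZ => wy; rewrite esym in euw.
  by have [_ <-] := side_cross exy euw wy uy.
by apply: contraNT uy => wZ; have [-> _] := side_cross est euw uZ wZ.
Qed.
End TreeTheory.

(** * Representations by path ends *)

Lemma path_edges_cons (T : finType) (x y : T) q :
  path_edges (x :: y :: q) = [set x; y] |: path_edges (y :: q).
Proof.
apply/setP=> F; rewrite !inE; apply/imsetP/orP => [[u]|[/eqP->|/imsetP[u uq ->]]].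
- rewrite inE => /orP[/eqP-> ->|uq ->]; first by left.
  by right; apply/imsetP; exists u.
- by exists (x, y); rewrite ?inE ?eqxx.
- by exists u; rewrite ?inE ?uq ?orbT.
Qed.

Lemma path_edges1 (T : finType) (x : T) : path_edges [:: x] = set0.
Proof. by apply/setP=> F; rewrite inE; apply/negbTE/imsetP=> -[]. Qed.

Lemma path_edges_mem (T : finType) (p : seq T) s t :
  [set s; t] \in path_edges p -> s \in p.
Proof.
case: p => [|x p]; first by case/imsetP.
elim: p x => [|y p IH] x; first by rewrite path_edges1 inE.
rewrite path_edges_cons 2!inE eq_set2 inE => /orP[|/IH->]; last by rewrite orbT.
by case/orP=> /andP[/eqP->]; rewrite ?inE !eqxx ?orbT.
Qed.

Lemma path_edges_edge (T : finType) (e : rel T) x q F :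
  path e x q -> F \in path_edges (x :: q) -> exists s t, e s t /\ F = [set s; t].
Proof.
elim: q x => [|y q IH] x /=; first by rewrite path_edges1 inE.
move=> /andP[exy pth]; rewrite path_edges_cons 2!inE => /orP[/eqP->|FP]; first by exists x, y.
exact: IH pth FP.
Qed.

(** Along the path, membership in the side changes exactly at the edge [s t], and this edge occurs
    at most once because no node is repeated. *)
Lemma path_edges_side (T : finType) (e : rel T) x q s t :
  tree e -> uniq (x :: q) -> path e x q -> e s t ->
  ([set s; t] \in path_edges (x :: q)) =
  ((x \in side e s t) != (last x q \in side e s t)).
Proof.
move=> etree + + est; elim: q x => [|y q IH] x.
  by rewrite path_edges1 inE eqxx.
rewrite [uniq _]/= => /andP[xq uq] /= /andP[exy pth].
rewrite path_edges_cons 2!inE (IH y) //.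
have [eq_st|ne_st] := eqVneq [set s; t] [set x; y]; last first.
  by rewrite (edge_side etree est exy) // eq_sym.
have : [set s; t] \notin path_edges (y :: q).
  by apply: contraNN xq; rewrite eq_st; exact: path_edges_mem.
rewrite (IH y) // negbK => /eqP <-; symmetry.
move/eqP: eq_st; rewrite eq_set2 => /orP[]/andP[/eqP sx /eqP ty]; subst.
  by rewrite side_in ?(negPf (side_notin etree est)).
by rewrite side_in ?(negPf (side_notin etree est)).
Qed.

Section EndRep.
Variables (V : finType) (adj : rel V).

Section Sep.
Variables (T : finType) (e : rel T) (a b : V -> T).

Definition sep s t v := (a v \in side e s t) != (b v \in side e s t).

(* A path of a tree is encoded by its two ends: it contains an edge iff the
   edge separates them. *)
Definition end_rep : Prop :=
  [/\ forall v, a v != b v,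
      forall v w, v != w ->
        adj v w <-> exists s t, [/\ e s t, sep s t v & sep s t w] &
      forall S : {set V}, S != set0 ->
        (forall v w, v \in S -> w \in S -> v != w -> adj v w) ->
        exists s t, e s t /\ forall v, v \in S -> sep s t v].

Definition end_rep_of_paths (P : V -> seq T) : Prop :=
  forall v, is_tree_path e (P v) /\
    exists x q, [/\ P v = x :: q, a v = x & b v = last x q].

Hypothesis etree : tree e.

Lemma sepC s t v : e s t -> sep t s v = sep s t v.
Proof.
by move=> est; rewrite /sep (sideC etree est) !in_setC; do 2!case: (_ \in _).
Qed.

Lemma sep_path_edges P : end_rep_of_paths P ->
  forall v s t, e s t -> ([set s; t] \in path_edges (P v)) = sep s t v.
Proof.
move=> PP v s t est; have [+ [x [q [Pv av bv]]]] := PP v.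
by rewrite Pv => -[_ uq pth]; rewrite (path_edges_side etree) // /sep av bv.
Qed.

Lemma path_edges_sep P : end_rep_of_paths P ->
  forall v F, F \in path_edges (P v) -> exists s t, [/\ e s t, F = [set s; t] & sep s t v].
Proof.
move=> PP v F; have [+ [x [q [Pv av bv]]]] := PP v.
rewrite Pv => -[_ uq pth] FP; have [s [t [est defF]]] := path_edges_edge pth FP.
by exists s, t; split; rewrite // -(sep_path_edges PP) // Pv -defF.
Qed.

Lemma path_edges_meet P : end_rep_of_paths P -> forall v w,
  path_edges (P v) :&: path_edges (P w) != set0 <->
  exists s t, [/\ e s t, sep s t v & sep s t w].
Proof.
move=> PP v w; split=> [/set0Pn[F]|[s [t [est sv sw]]]].
  rewrite inE => /andP[/(path_edges_sep PP)[s [t [est defF sv]]]].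
  by rewrite defF (sep_path_edges PP) // => sw; exists s, t.
by apply/set0Pn; exists [set s; t]; rewrite inE !(sep_path_edges PP) // sv.
Qed.

Lemma end_repP P : end_rep_of_paths P ->
  (is_tree e /\ end_rep) <-> (EPT_rep adj e P /\ Helly_rep P).
Proof.
move=> PP; split=> [[te [ab adjP hellyP]]|[[te _ adjP] hellyP]].
  split; first split=> //.
  - by move=> v; have [] := PP v.
  - by move=> v w /adjP->; rewrite path_edges_meet.
  move=> S pwS; have [->|S0] := eqVneq S set0.
    (* The intersection of the empty family is the set of all node sets, so any member is a witness.
       In [end_rep] the empty family is excluded, since the tree may have no edge. *)
    by apply/set0Pn; exists set0; rewrite big_set0 inE.
  have [|s [t [est sepS]]] := hellyP S S0.
    by move=> v w Sv Sw vw; apply/adjP=> //; apply/(path_edges_meet PP); apply: pwS.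
  by apply/set0Pn; exists [set s; t]; apply/bigcapP=> v /sepS; rewrite (sep_path_edges PP).
split=> //; split.
- move=> v; have [+ [x [q [Pv av bv]]]] := PP v; rewrite Pv => -[q0 uq _].
  rewrite av bv; case: q q0 uq {Pv bv} => // y q _ /= /andP[xq _].
  by apply: contraNneq xq => ->; exact: mem_last.
- by move=> v w /adjP->; rewrite path_edges_meet.
- move=> S /set0Pn[v0 Sv0] pwS; have /hellyP/set0Pn[F /bigcapP FS] : forall v w,
    v \in S -> w \in S -> path_edges (P v) :&: path_edges (P w) != set0.
    move=> v w Sv Sw; have [->|vw] := eqVneq v w; last by apply/adjP => //; apply: pwS.
    rewrite setIid; have [+ [x [q [Pw _ _]]]] := PP w; rewrite Pw; case: q {Pw} => [[]//|y q _].
    by apply/set0Pn; exists [set x; y]; rewrite path_edges_cons setU11.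
  have [s [t [est defF _]]] := path_edges_sep PP (FS _ Sv0).
  by exists s, t; split=> // v /FS; rewrite defF (sep_path_edges PP).
Qed.

Lemma paths_of_ends : (forall v, a v != b v) -> exists P, end_rep_of_paths P.
Proof.
move=> ab; have econn : forall x y, connect e x y by case: etree.
suff /fin_all_exists[P PP] : forall v, exists p, is_tree_path e p /\
    exists x q, [/\ p = x :: q, a v = x & b v = last x q] by exists P.
move=> v; have /connectP[p pth def_b] := econn (a v) (b v).
case/shortenP: pth def_b => q pth uq _ def_b.
exists (a v :: q); split; last by exists (a v), q.
by split=> //; apply: contraNneq (ab v) => q0; rewrite def_b q0.
Qed.
End Sep.

Lemma Helly_EPT_ends : Helly_EPT adj ->
  exists (T : finType) (e : rel T) (a b : V -> T),
    [/\ 0 < #|T|, tree e & end_rep e a b].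
Proof.
move=> [T [e [P [rep helly]]]]; have [te pathP _] := rep.
have T0 : 0 < #|T| by case: te.
have /card_gt0P[x0 _] := T0.
pose a v := head x0 (P v); pose b v := last x0 (P v).
exists T, e, a, b; split=> //; first exact: is_tree_tree.
have PP : end_rep_of_paths e a b P.
  move=> v; split=> //; have := pathP v.
  by rewrite /a /b; case: (P v) => // x q _; exists x, q.
by have [] := (end_repP (is_tree_tree te) PP).2.
Qed.

Lemma Helly_h22_ends h : Helly_h22 adj h <->
  exists (T : finType) (e : rel T) (a b : V -> T),
    [/\ 0 < #|T|, tree e, end_rep e a b & max_degree e = h].
Proof.
split=> [[T [e [P [rep degh helly]]]]|[T [e [a [b [T0 te rep degh]]]]]].
  have [te pathP _] := rep.
  have T0 : 0 < #|T| by case: te.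
  have /card_gt0P[x0 _] := T0.
  pose a v := head x0 (P v); pose b v := last x0 (P v).
  exists T, e, a, b; split=> //; first exact: is_tree_tree.
  have PP : end_rep_of_paths e a b P.
    move=> v; split=> //; have := pathP v.
    by rewrite /a /b; case: (P v) => // x q _; exists x, q.
  by have [] := (end_repP (is_tree_tree te) PP).2.
have [ab _ _] := rep; have [P PP] := paths_of_ends te ab.
have [repP helly] := (end_repP te PP).1 (conj (tree_is_tree T0 te) rep).
by exists T, e, P.
Qed.
End EndRep.

(** * Splitting a node *)

Definition deg (T : finType) (e : rel T) z := #|[set y | e z y]|.

Section Split.
Variables (T : finType) (e : rel T) (x : T) (N : {set T}).
Hypotheses (etree : tree e) (eN : forall y, y \in N -> e x y).

Let esym : symmetric e. Proof. by case: etree. Qed.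
Let econn : forall u w, connect e u w. Proof. by case: etree. Qed.
Let xN : x \in N = false.
Proof. by apply/negP=> /eN; rewrite (tree_irr etree). Qed.

(* The vertex x is split into the adjacent vertices [Some x] and [None]; the
   latter takes over the neighbours in N. *)
Definition split_rel : rel (option T) := fun u w =>
  match u, w with
  | Some u, Some w =>
      [&& e u w, ~~ ((u == x) && (w \in N)) & ~~ ((w == x) && (u \in N))]
  | Some u, None | None, Some u => (u == x) || (u \in N)
  | None, None => false
  end.

(* The side of [Some x] across the new edge. *)
Definition stay : {set T} :=
  [set z | (z == x) || [exists y, [&& e x y, y \notin N & z \in side e x y]]].

Local Notation pi := (odflt x).

Lemma split_sym : symmetric split_rel.
Proof. by case=> [u|] [w|] //=; rewrite esym andbA andbAC -andbA. Qed.

Lemma split_conn u w : connect split_rel u w.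
Proof.
have sym := sym_connect_sym split_sym.
have c0 : connect split_rel (Some x) None by apply: connect1; rewrite /= eqxx.
have cz z : connect split_rel (Some x) (Some z).
  have: z \in [pred z | connect split_rel (Some x) (Some z)].
    apply: connect_ind (econn x z) _ => [s t est|]; rewrite !inE ?connect0 //.
    move=> /connect_trans; apply.
    have [/andP[/eqP-> tN]|ns] := boolP ((s == x) && (t \in N)).
      by apply: connect_trans c0 _; apply: connect1; rewrite /= tN orbT.
    have [/andP[/eqP-> sN]|nt] := boolP ((t == x) && (s \in N)).
      by rewrite sym; apply: connect_trans c0 _; apply: connect1; rewrite /= sN orbT.
    by apply: connect1; rewrite /= est ns nt.
  by rewrite inE.
have cx u' : connect split_rel (Some x) u' by case: u'.
by apply: connect_trans (cx w); rewrite sym.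
Qed.

Lemma split_edge u w : split_rel u w -> pi u != pi w -> e (pi u) (pi w).
Proof.
case: u w => [u|] [w|] //=; first by case/andP.
  by case: eqVneq => //= _ /eN; rewrite esym.
by rewrite [w == x]eq_sym; case: eqVneq => //= _ /eN.
Qed.

Lemma split_lift s t : e s t ->
  exists u w, [/\ split_rel u w, pi u = s & pi w = t].
Proof.
move=> est.
have [/andP[/eqP sx tN]|ns] := boolP ((s == x) && (t \in N)).
  by exists None, (Some t); rewrite /= tN orbT.
have [/andP[/eqP tx sN]|nt] := boolP ((t == x) && (s \in N)).
  by exists (Some s), None; rewrite /= sN orbT.
by exists (Some s), (Some t); rewrite /= est ns nt.
Qed.

Lemma split_new u w : split_rel u w -> pi u = pi w ->
  (u = None /\ w = Some x) \/ (u = Some x /\ w = None).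
Proof.
case: u w => [u|] [w|] //=; first by move=> + uw; rewrite uw (tree_irr etree).
  by move=> _ ->; right.
by move=> _ <-; left.
Qed.

(** An edge lying over an edge of [e] uses the copy [None] of [x] exactly when it leads to [N];
    hence its projection determines it. *)
Lemma split_relE u w : split_rel u w -> pi u != pi w ->
  u = if (pi u == x) && (pi w \in N) then None else Some (pi u).
Proof.
case: u w => [u|] [w|] //=; first by case/and3P=> _ /negPf->.
  by move=> _ /negPf->.
by rewrite eqxx [w == x]eq_sym => /orP[->|->].
Qed.

Lemma split_lift_inj u w u' w' : split_rel u w -> split_rel u' w' ->
  pi u != pi w -> pi u = pi u' -> pi w = pi w' -> u = u' /\ w = w'.
Proof.
move=> uw uw' ne eu ew; have ne' : pi u' != pi w' by rewrite -eu -ew.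
split; first by rewrite (split_relE uw ne) (split_relE uw' ne') eu ew.
rewrite split_sym in uw; rewrite split_sym in uw'; rewrite eq_sym in ne; rewrite eq_sym in ne'.
by rewrite (split_relE uw ne) (split_relE uw' ne') eu ew.
Qed.

Lemma split_side_old u w : split_rel u w -> pi u != pi w ->
  is_side split_rel u w [set z | pi z \in side e (pi u) (pi w)].
Proof.
move=> uw puw; have euw := split_edge uw puw; split.
- by rewrite inE (side_in etree).
- by rewrite inE (side_notin etree).
- move=> p q pq; rewrite !inE => pZ qZ.
  have ppq : pi p != pi q by apply: contraNneq qZ => <-.
  have [pw qu] := side_cross etree euw (split_edge pq ppq) pZ qZ.
  by have [] := split_lift_inj pq (etrans (split_sym w u) uw) ppq pw qu.
Qed.

Lemma split_side_new : is_side split_rel None (Some x) [set Some z | z in stay].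
Proof.
split; first by apply: imset_f; rewrite !inE eqxx.
  by apply/imsetP=> -[].
move=> p q pq /imsetP[u uS def_p]; subst p; case: q pq => [w|] /= pq wS.
  have {}wS : w \notin stay by apply: contraNN wS => wS; apply: imset_f.
  case/and3P: pq => euw nuN nwN; case/negP: wS; move: uS.
  rewrite !inE => /orP[/eqP ux|/existsP[y /and3P[exy yN uy]]].
    apply/orP; right; apply/existsP; exists w; subst u.
    by rewrite eqxx in nuN; rewrite euw nuN (side_in etree).
  have [wy|wy] := boolP (w \in side e x y).
    by apply/orP; right; apply/existsP; exists y; rewrite exy yN.
  by have [_ ->] := side_cross etree exy euw uy wy; rewrite eqxx.
split=> //; congr Some; move: pq uS; case: eqVneq => //= _ uN.
rewrite inE => /orP[/eqP//|/existsP[y /and3P[exy yN]]].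
by rewrite (nbr_side etree exy (eN uN)) => /eqP uy; rewrite uy (negPf yN) in uN.
Qed.

Lemma split_tree : tree split_rel.
Proof.
apply: side_tree split_sym split_conn _ => u w uw.
have [pE|pne] := eqVneq (pi u) (pi w); last by eexists; apply: split_side_old.
have [[-> ->]|[-> ->]] := split_new uw pE.
  by eexists; apply: split_side_new.
eexists; apply: (is_sideC split_sym); exact: split_side_new.
Qed.

Lemma side_split_old u w z : split_rel u w -> pi u != pi w ->
  (z \in side split_rel u w) = (pi z \in side e (pi u) (pi w)).
Proof.
move=> uw puw.
by rewrite (is_sideE split_sym split_conn (split_side_old uw puw)) inE.
Qed.

Lemma side_split_new z :
  (z \in side split_rel None (Some x)) = (if z is Some z' then z' \in stay else false).
Proof.
rewrite (is_sideE split_sym split_conn split_side_new).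
by case: z => [z|]; [rewrite mem_imset //; apply: Some_inj|apply/imsetP=> -[]].
Qed.

(* A path end at x goes to the copy of x from which the path to its other end d
   leaves. *)
Definition lift_end (c d : T) : option T :=
  if c == x then if d \in stay then Some x else None else Some c.

Lemma lift_endK c d : pi (lift_end c d) = c.
Proof. by rewrite /lift_end; case: eqVneq => [->|] //; case: ifP. Qed.

(** An end at [x] is lifted to the copy on the same side as the other end. So a path crosses the new
    edge only if it has no end at [x], and it then passes from one branch to another. *)
Lemma lift_end_sep c d : c != d ->
  lift_end c d \in side split_rel None (Some x) ->
  lift_end d c \notin side split_rel None (Some x) ->
  exists y y', [/\ e x y, y \notin N, y' \in N,
    c \in side e x y /\ d \notin side e x y &
    d \in side e x y' /\ c \notin side e x y'].
Proof.
move=> cd; rewrite !side_split_new /lift_end.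
have [cx|cx] := eqVneq c x.
  rewrite cx; have dx : d != x by rewrite -cx eq_sym.
  by case: ifP => // dS; rewrite (negPf dx) dS.
move=> cS; have [dx|dx dS] := eqVneq d x.
  by rewrite cS dx inE eqxx.
move: cS; rewrite inE (negPf cx) => /existsP[y /and3P[exy yN cy]].
have [y' exy' dy'] := side_cover etree dx.
have y'N : y' \in N.
  apply: contraNT dS => y'N; rewrite inE; apply/orP; right.
  by apply/existsP; exists y'; rewrite exy' y'N.
have yy' : y != y' by apply: contraNneq yN => ->.
exists y, y'; split=> //; split=> //; apply: contraNN yy' => H.
  by rewrite (side_disjoint etree exy exy' H dy').
by rewrite (side_disjoint etree exy exy' cy H).
Qed.

Section Ends.
Variables (V : finType) (adj : rel V) (a b : V -> T).

Definition lift_fst v := lift_end (a v) (b v).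
Definition lift_snd v := lift_end (b v) (a v).

Lemma sep_split_old u w v : split_rel u w -> pi u != pi w ->
  sep split_rel lift_fst lift_snd u w v = sep e a b (pi u) (pi w) v.
Proof. by move=> uw puw; rewrite /sep !side_split_old // !lift_endK. Qed.

Lemma sep_split_new v : a v != b v ->
  sep split_rel lift_fst lift_snd None (Some x) v ->
  exists y y', [/\ e x y, y \notin N, y' \in N, sep e a b x y v & sep e a b x y' v].
Proof.
move=> ab; rewrite /sep.
have [aS|aS] := boolP (lift_fst v \in _) => bS.
  have [y [y' [exy yN y'N [cy dy] [dy' cy']]]] := lift_end_sep ab aS bS.
  by exists y, y'; rewrite cy dy' (negPf dy) (negPf cy').
rewrite eq_sym in ab.
have [|y [y' [exy yN y'N [cy dy] [dy' cy']]]] := lift_end_sep ab _ aS.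
  by move: bS; rewrite eq_sym eqbF_neg negbK.
by exists y, y'; rewrite cy dy' (negPf dy) (negPf cy').
Qed.

(** Old edges keep the paths they carry, so adjacencies and common edges of complete sets persist.
    New adjacencies could come only from the new edge, whose paths share an old edge by
    hypothesis. *)
Lemma end_rep_split : end_rep adj e a b ->
  (forall S : {set V}, S != set0 ->
     (forall v, v \in S -> sep split_rel lift_fst lift_snd None (Some x) v) ->
     exists s t, e s t /\ forall v, v \in S -> sep e a b s t v) ->
  end_rep adj split_rel lift_fst lift_snd.
Proof.
move=> [ab adjP hellyP] newP; split.
- by move=> v; apply: contraNneq (ab v) => /(congr1 pi); rewrite !lift_endK => ->.
- move=> v w vw; rewrite adjP //; split=> [[s [t [est sv sw]]]|[p [q [pq sv sw]]]].
    have [p [q [pq ps qt]]] := split_lift est.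
    have st : s != t by apply: contraTneq est => ->; rewrite (tree_irr etree).
    by exists p, q; rewrite !sep_split_old ?ps ?qt.
  have [pE|pne] := eqVneq (pi p) (pi q); last first.
    by exists (pi p), (pi q); rewrite -!sep_split_old //; split=> //; apply: split_edge.
  have [||s [t [est sS]]] := newP [set v; w].
  + by apply/set0Pn; exists v; rewrite !inE eqxx.
  + have sepN u : sep split_rel lift_fst lift_snd p q u ->
      sep split_rel lift_fst lift_snd None (Some x) u.
      have [[-> ->]|[-> ->]] // := split_new pq pE.
      by rewrite (sepC _ _ split_tree) //= eqxx.
    by move=> u; rewrite !inE => /orP[]/eqP->; apply: sepN.
  by exists s, t; split=> //; apply: sS; rewrite !inE eqxx ?orbT.
- move=> S S0 /(hellyP S S0)[s [t [est sS]]].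
  have [p [q [pq ps qt]]] := split_lift est.
  have st : s != t by apply: contraTneq est => ->; rewrite (tree_irr etree).
  by exists p, q; split=> // v /sS; rewrite sep_split_old ?ps ?qt.
Qed.
End Ends.

Lemma deg_split_None : deg split_rel None = #|N|.+1.
Proof.
rewrite /deg; have -> : [set y | split_rel None y] = [set Some z | z in x |: N].
  apply/setP=> -[z|]; last by rewrite inE; symmetry; apply/imsetP=> -[].
  by rewrite inE mem_imset ?inE //; apply: Some_inj.
by rewrite card_imset ?cardsU1 ?xN //; apply: Some_inj.
Qed.

Lemma deg_split_x : deg split_rel (Some x) = (deg e x - #|N|).+1.
Proof.
rewrite /deg; have -> : [set y | split_rel (Some x) y] =
    None |: [set Some z | z in [set y | e x y] :\: N].
  apply/setP=> -[z|]; last by rewrite !inE /= eqxx.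
  rewrite !inE mem_imset ?inE /= ?eqxx ?xN ?andbF ?andbT 1?andbC //=.
  exact: Some_inj.
rewrite cardsU1 card_imset; last by apply: Some_inj.
case: imsetP => [[]//|_]; rewrite cardsD (setIidPr _) //.
by apply/subsetP=> y; rewrite inE => /eN.
Qed.

Lemma deg_split_old u : u != x -> deg split_rel (Some u) = deg e u.
Proof.
(* [f] maps the old neighbours of [u] to the new ones: only [x] can change, becoming [None] when [u]
   is in [N]. *)
move=> ux; pose f w := if (w == x) && (u \in N) then None else Some w.
rewrite /deg; have -> : [set y | split_rel (Some u) y] = [set f w | w in [set y | e u y]].
  apply/setP=> -[z|]; rewrite inE /=; last first.
    rewrite (negPf ux) orFb; apply/idP/imsetP => [uN|[w]].
      by exists x; rewrite ?inE 1?esym ?eN // /f eqxx uN.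
    by rewrite /f; case: andP => // -[].
  rewrite (negPf ux) /=; apply/andP/imsetP => [[euz nz]|[w]].
    by exists z; rewrite ?inE // /f (negPf nz).
  by rewrite inE /f; case: ifP => // /negbT nw euw [->].
apply: card_imset => w w'; rewrite /f.
by do 2!case: ifP => //; [move=> /andP[/eqP-> _] /andP[/eqP->]|move=> _ _ []].
Qed.
End Split.

(** * The graph formed by the paths at one node *)

(** For sets [E v] of at most two elements this is 2-connectedness in cut form of the graph with
    vertex set [D] and edges the pairs among the [E v]: after deleting any [y], every cut is
    crossed. *)
Definition biconn (T V : finType) (D : {set T}) (E : V -> {set T}) (S : {set V}) : bool :=
  [forall y in D, forall A : {set T},
     [&& A \subset D :\ y, A != set0 & A != D :\ y] ==>
     [exists v in S, (E v :&: A != set0) && (E v :&: ((D :\ y) :\: A) != set0)]].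

Section Local.
Variables (V T : finType) (e : rel T) (a b : V -> T) (x : T).
Hypothesis etree : tree e.

Definition star_ends v : {set T} := [set y | e x y && sep e a b x y v].

(** An edge at [x] that separates the ends of the path has one of them beyond it, and each end lies
    beyond at most one edge at [x]. *)
Lemma card_star_ends v : #|star_ends v| <= 2.
Proof.
pose branch c := [set y | e x y && (c \in side e x y)].
have card_branch c : #|branch c| <= 1.
  apply/card_le1_eqP => y y'; rewrite !inE => /andP[exy cy] /andP[exy' cy'].
  exact: (side_disjoint etree exy' exy cy' cy).
have /subset_leq_card/leq_trans : star_ends v \subset branch (a v) :|: branch (b v).
  apply/subsetP=> y; rewrite !inE /sep => /andP[-> /=].
  by case: (a v \in _) => //; case: (b v \in _).
apply; rewrite (leq_trans (leq_card_setU _ _)) //.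
by rewrite -[2]/(1 + 1) leq_add.
Qed.

(** The side of [s t] away from [x] lies beyond one edge [x y]. A path using [s t] but not [x y] has
    both ends beyond [x y], so it uses no edge at [x]. This transfers common edges to [x]. *)
Lemma star_ends_branch s t : e s t ->
  exists2 y, e x y & forall v, star_ends v != set0 ->
    sep e a b s t v -> y \in star_ends v.
Proof.
move=> est; wlog xst : s t est / x \notin side e s t.
  move=> H; have [xst|xst] := boolP (x \in side e s t); last exact: H est xst.
  have ets : e t s by case: etree => esym _ _; rewrite esym.
  have [|y exy yP] := H t s ets; first by rewrite (sideC etree est) inE xst.
  by exists y => // v v0 sv; apply: yP => //; rewrite (sepC _ _ etree).
have tx : t != x by apply: contraNneq xst => <-; rewrite (side_in etree).
have [y exy ty] := side_cover etree tx.
have /subsetP sub := side_sub_branch etree exy est xst ty.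
exists y => // v v0 sv; rewrite inE exy /=.
apply: contraNT v0 => nsep; apply/eqP/setP=> y'; rewrite inE in_set0.
apply/negP=> /andP[exy'].
have [->|y'y] := eqVneq y' y; first by apply/negP.
have [ay by_] : a v \in side e x y /\ b v \in side e x y.
  move: sv nsep; rewrite /sep negbK.
  have [/sub ->|_] := boolP (a v \in side e s t); first by move=> _ /eqP <-.
  by have [/sub ->|] := boolP (b v \in side e s t) => // _ /eqP.
have out c : c \in side e x y -> c \in side e x y' = false.
  move=> cy; apply: contraNF y'y => cy'.
  by rewrite (side_disjoint etree exy' exy cy' cy).
by rewrite /sep !out.
Qed.

Lemma star_ends_sep y v : y \in star_ends v -> e x y /\ sep e a b x y v.
Proof. by rewrite inE => /andP. Qed.

Variable adj : rel V.
Hypothesis rep : end_rep adj e a b.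

Lemma adj_star_ends v w : v != w -> star_ends v != set0 -> star_ends w != set0 ->
  adj v w = (star_ends v :&: star_ends w != set0).
Proof.
case: rep => _ adjP _ vw v0 w0; apply/idP/set0Pn => [/adjP|[y]].
  case=> // s [t [est sv sw]]; have [y exy yP] := star_ends_branch est.
  by exists y; rewrite inE !yP.
rewrite inE => /andP[/star_ends_sep[exy sv] /star_ends_sep[_ sw]].
by apply/adjP => //; exists x, y.
Qed.
End Local.

(** * Lowering the degrees of the host tree *)

Lemma big_option (T : finType) (F : option T -> nat) :
  \sum_u F u = F None + \sum_z F (Some z).
Proof.
rewrite (bigD1 None) //=; congr (_ + _).
rewrite (reindex_omap Some id) /=; last by case.
by apply: eq_bigl => z; rewrite eqxx.
Qed.

Definition excess (T : finType) (e : rel T) := \sum_x (deg e x - 3).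

Lemma max_degreeE (T : finType) (e : rel T) : max_degree e = \max_x deg e x.
Proof. by []. Qed.

Section Reduce.
Variables (V : finType) (adj : rel V).

Definition has_rep (T : finType) (e : rel T) : Prop :=
  0 < #|T| /\ tree e /\ exists a b : V -> T, end_rep adj e a b.

(** The maximum degree has to be exactly [h]. Splitting a node of maximum degree with [N] empty
    attaches a leaf that no path reaches and raises the maximum by one. *)
Lemma has_rep_pad (T : finType) (e : rel T) h : has_rep e -> max_degree e <= h -> Helly_h22 adj h.
Proof.
move: {2}(h - max_degree e) (leqnn (h - max_degree e)) => n.
elim: n T e => [|n IH] T e.
  move=> le0 [T0 [te [a [b rep]]]] deg_h; apply/Helly_h22_ends.
  exists T, e, a, b; split=> //; lia.
move=> le_n rep deg_h; have [eq_h|ne_h] := eqVneq (max_degree e) h.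
  by apply: (IH T e) => //; lia.
have [T0 [te [a [b ab]]]] := rep.
have [x0 x0max] := eq_bigmax (deg e) T0.
have N0 y : y \in set0 -> e x0 y by rewrite inE.
have maxE : max_degree (split_rel e x0 set0) = (max_degree e).+1.
  rewrite !max_degreeE x0max; apply/eqP; rewrite eqn_leq; apply/andP; split.
    apply/bigmax_leqP => -[z|] _; last by rewrite deg_split_None // cards0.
    have [->|zx] := eqVneq z x0; first by rewrite deg_split_x // cards0 subn0.
    by rewrite deg_split_old // leqW // -x0max leq_bigmax.
  apply: leq_trans (leq_bigmax (Some x0)).
  by rewrite deg_split_x // cards0 subn0.
apply: (IH _ (split_rel e x0 set0)); rewrite ?maxE; try lia.
split; first by rewrite card_option.
split; first exact: split_tree.
exists (lift_fst e x0 set0 a b), (lift_snd e x0 set0 a b).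
apply: end_rep_split => // S /set0Pn[v Sv] /(_ v Sv) sv.
have [abne _ _] := ab.
have [y [y' [_ _]]] := sep_split_new te N0 (abne v) sv; by rewrite inE.
Qed.

(** If deleting [y0] leaves parts [A] and [B] joined by no path, let the new node take [y0] and [B].
    A path over the new edge goes from [A] to [y0], so all such paths share the edge [x y0]. *)
Lemma has_rep_reduce (T : finType) (e : rel T) a b x : has_rep e -> end_rep adj e a b ->
  3 < deg e x -> ~~ biconn [set y | e x y] (star_ends e a b x) setT ->
  exists (T' : finType) (e' : rel T'), has_rep e' /\ excess e' < excess e.
Proof.
move=> [T0 [te _]] rep deg_x; rewrite /biconn negb_forall => /existsP[y0].
rewrite negb_imply inE => /andP[exy0]; rewrite negb_forall => /existsP[A].
rewrite negb_imply => /andP[/and3P[AD A0 AnD]].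
set D := [set y | e x y] in AD AnD *; set B := (D :\ y0) :\: A.
rewrite negb_exists => /forallP nocross.
have {}nocross v y y' : y \in A -> y' \in B -> sep e a b x y v -> ~~ sep e a b x y' v.
  move=> yA y'B sy; apply/negP=> sy'; have /negP := nocross v; apply.
  rewrite inE /=; apply/andP; split; apply/set0Pn; [exists y|exists y'].
    by have := subsetP AD y yA; rewrite !inE sy yA !andbT => /andP[].
  by have := y'B; rewrite !inE sy' => /and3P[-> -> ->].
have B0 : B != set0.
  by apply: contraNneq AnD => B0; rewrite eqEsubset AD -setD_eq0 -/B B0 eqxx.
have [BD dAB cardD] : [/\ B \subset D :\ y0, [disjoint A & B] & #|A| + #|B| = #|D|.-1].
  split; first exact: subsetDl.
    by rewrite -setI_eq0 /B setDE setICA setICr setI0.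
  rewrite /B cardsD (setIidPr AD) subnKC ?subset_leq_card //.
  by rewrite (cardsD1 y0 D) inE exy0.
move: {AnD} (B) A0 B0 AD BD dAB cardD nocross => {}B.
(* The new degrees are [|A| + 1] and [|B| + 2]. With [|A| >= 2] their excesses over 3 add up to
   [|A| + |B| - 3], one less than that of [x]. Since [deg e x > 3], one of the parts has two
   elements. *)
wlog A2 : A B / 1 < #|A|.
  move=> H A0 B0 AD BD dAB cardD nocross.
  have [A2|A2] := ltnP 1 #|A|; first exact: (H A B).
  apply: (H B A) => //; first by rewrite /deg -/D in deg_x; lia.
  - by rewrite disjoint_sym.
  - by rewrite addnC.
  - by move=> v y y' yB y'A; apply: contraTN => /nocross; apply.
move=> A0 B0 AD BD dAB cardD nocross.
pose N := y0 |: B.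
have eN y : y \in N -> e x y.
  by rewrite !inE => /orP[/eqP->//|/(subsetP BD)]; rewrite !inE => /andP[].
have cardN : #|N| = #|B|.+1.
  by rewrite cardsU1; case: (boolP (y0 \in B)) => // /(subsetP BD); rewrite !inE eqxx.
exists (option T), (split_rel e x N); split; last first.
  rewrite /excess big_option deg_split_None // (bigD1 x) //= deg_split_x //.
  rewrite [X in _ < X](bigD1 x) //= cardN.
  rewrite (eq_bigr (fun z => deg e z - 3)) => [|z zx]; last by rewrite deg_split_old.
  rewrite /deg -/D in deg_x *.
  rewrite -card_gt0 in B0; lia.
split; first by rewrite card_option.
split; first exact: split_tree.
exists (lift_fst e x N a b), (lift_snd e x N a b).
have [abne _ _] := rep.
apply: end_rep_split => // S S0 sS; exists x, y0; split=> // v /sS sv.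
have [y [y' [exy yN y'N sy sy']]] := sep_split_new te eN (abne v) sv.
have yA : y \in A.
  have : #|A :|: B| = #|D :\ y0|.
    rewrite cardsU (disjoint_setI0 dAB) cards0 subn0 cardD.
    by rewrite (cardsD1 y0 D) inE exy0.
  move=> /esym/eqP cE; have : A :|: B = D :\ y0.
    by apply/eqP; rewrite eqEcard subUset AD BD (eqP cE) leqnn.
  move=> /setP/(_ y); move: yN; rewrite !inE negb_or exy => /andP[-> /negPf->].
  by rewrite orbF.
move: y'N; rewrite !inE => /orP[/eqP <-//|y'B].
by have := nocross v y y' yA y'B sy; rewrite sy'.
Qed.

(** Induction on the excess: while some node has degree above [h], either its local graph is
    2-connected or a split lowers the excess. At excess 0 all degrees are at most 3, hence at most
    [h]. *)
Lemma reduce_or_biconn (T : finType) (e : rel T) h : 3 <= h -> has_rep e ->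
  Helly_h22 adj h \/
  exists (T' : finType) (e' : rel T') (a b : V -> T') x,
    [/\ tree e', end_rep adj e' a b, h < deg e' x &
        biconn [set y | e' x y] (star_ends e' a b x) setT].
Proof.
move=> h3; move: {2}(excess e) (leqnn (excess e)) => n.
elim: n T e => [|n IH] T e le_n rep.
  have [T0 [te [a [b ab]]]] := rep.
  left; apply: has_rep_pad rep _; apply/bigmax_leqP=> x _.
  move: le_n; rewrite /excess (bigD1 x) //=; rewrite /deg; lia.
have [T0 [te [a [b ab]]]] := rep.
have [/forallP le_h|] := boolP [forall x, deg e x <= h].
  by left; apply: has_rep_pad rep _; apply/bigmax_leqP=> x _; apply: le_h.
rewrite negb_forall => /existsP[x]; rewrite -ltnNge => degx.
have [bi|nbi] := boolP (biconn [set y | e x y] (star_ends e a b x) setT).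
  by right; exists T, e, a, b, x.
have [|T' [e' [rep' lt_e]]] := has_rep_reduce rep ab _ nbi; first exact: leq_ltn_trans degx.
by apply: (IH T' e') => //; rewrite -ltnS (leq_trans lt_e).
Qed.
End Reduce.

(** * Connectivity of gates *)

(* lia restricted to the arithmetical hypotheses: its preprocessing is very slow
   on membership and set hypotheses. *)
Ltac arithmetical P :=
  lazymatch P with
  | @eq nat _ _ => idtac
  | is_true (leq _ _) => idtac
  | is_true (andb ?a ?b) => arithmetical (is_true a); arithmetical (is_true b)
  | is_true (orb ?a ?b) => arithmetical (is_true a); arithmetical (is_true b)
  | is_true (negb ?a) => arithmetical (is_true a)
  | is_true (@eq_op _ ?a _) => let _ := constr:(a : nat) in idtac
  end.

Ltac arith :=
  repeat match goal with
  | H : ?P |- _ => tryif arithmetical P then fail else clear H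
  end; lia.

Lemma next_index (V : eqType) (c : seq V) x y :
  uniq c -> x \in c -> y \in c ->
  (y == next c x) = (index y c == (index x c).+1 %% size c).
Proof.
move=> uc xc yc; have ltx : index x c < size c by rewrite index_mem.
rewrite next_nth xc; case: c uc xc yc ltx => // z c uc xc yc ltx.
have -> : nth z c (index x (z :: c)) = nth z (z :: c) ((index x (z :: c)).+1 %% size (z :: c)).
  have [lt|ge] := ltnP (index x (z :: c)).+1 (size (z :: c)).
    by rewrite modn_small.
  have -> : (index x (z :: c)).+1 = size (z :: c) by apply/eqP; rewrite eqn_leq ltx.
  by rewrite modnn /= nth_default //; rewrite /= ltnS in ge.
have ltm : (index x (z :: c)).+1 %% size (z :: c) < size (z :: c) by rewrite ltn_mod.
by rewrite -{1}(nth_index z yc) nth_uniq // index_mem.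
Qed.

Section Gates.
Variables (V : finType) (adj : rel V).
Hypothesis adj_sym : symmetric adj.

Definition complete (Q : {set V}) : Prop :=
  forall x y, x \in Q -> y \in Q -> x != y -> adj x y.

Definition adj_off (S Q : {set V}) : rel V :=
  fun u w => [&& u \in S :\: Q, w \in S :\: Q & adj u w].

Lemma adj_off_sym S Q : symmetric (adj_off S Q).
Proof. by move=> u w; rewrite /adj_off adj_sym andbCA. Qed.

Lemma cycle_adj_nth x0 c i j : uniq c -> induces_cycle adj c ->
  i < size c -> j < size c ->
  adj (nth x0 c i) (nth x0 c j) =
  [|| j == i.+1, i == j.+1, (i.+1 == size c) && (j == 0) | (j.+1 == size c) && (i == 0)].
Proof.
move=> uc icyc lti ltj; rewrite icyc ?mem_nth // !next_index ?mem_nth // !index_uniq //.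
have mod_succ k m : k < size c -> m < size c ->
    (m == k.+1 %% size c) = (m == k.+1) || ((k.+1 == size c) && (m == 0)).
  move=> ltk ltm; have [lt|ge] := ltnP k.+1 (size c).
    by rewrite modn_small // (ltn_eqF lt) orbF.
  have -> : k.+1 = size c by arith.
  by rewrite modnn eqxx (ltn_eqF ltm).
by rewrite !mod_succ //; case: (_ && _); rewrite ?orbT //= orbF orbA.
Qed.

Lemma connect_chain (r : rel V) (f : nat -> V) lo hi : lo <= hi ->
  (forall i, lo <= i < hi -> r (f i) (f i.+1)) -> connect r (f lo) (f hi).
Proof.
move=> le_lh; rewrite -(subnKC le_lh); elim: (hi - lo) => [|m IH] rf.
  by rewrite addn0 connect0.
rewrite addnS; apply: connect_trans (IH _) (connect1 _) => [i Hi|]; apply: rf; arith.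
Qed.

(** Not complete and without a complete separator: the invariant carried through the recursive
    construction of gates. *)
Definition robust (S : {set V}) : Prop :=
  (exists u w, [/\ u \in S, w \in S, u != w & ~~ adj u w]) /\
  (forall Q, complete Q -> forall x y, x \in S :\: Q -> y \in S :\: Q ->
     connect (adj_off S Q) x y).

(** Two members of a complete set are consecutive on the cycle, so at most one of the two arcs
    between the remaining vertices is blocked. *)
Lemma cycle_robust c : uniq c -> 4 <= size c -> induces_cycle adj c ->
  robust [set x in c].
Proof.
move=> uc c4 icyc; case Dc : c => [|x0 c']; first by rewrite Dc in c4.
rewrite -Dc; have adjE i j := cycle_adj_nth x0 uc icyc (i := i) (j := j).
have nthc i : i < size c -> nth x0 c i \in [set x in c] by move=> ?; rewrite inE mem_nth.
split.
- exists (nth x0 c 0), (nth x0 c 2).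
  split; rewrite ?nthc ?adjE ?nth_uniq //; arith.
- move=> Q cQ.
  suff Hlt i k : i < k -> k < size c -> nth x0 c i \in [set x in c] :\: Q ->
      nth x0 c k \in [set x in c] :\: Q ->
      connect (adj_off [set x in c] Q) (nth x0 c i) (nth x0 c k).
    move=> x y xS yS; have [xc yc] : x \in c /\ y \in c.
      by move: xS yS; rewrite !inE => /andP[_ ->] /andP[_ ->].
    rewrite -(nth_index x0 xc) -(nth_index x0 yc) in xS yS *.
    have [ltx lty] : index x c < size c /\ index y c < size c by rewrite !index_mem.
    case: (ltngtP (index x c) (index y c)) => [lt|lt|->]; last exact: connect0.
      exact: Hlt.
    rewrite (sym_connect_sym (@adj_off_sym _ _)); exact: Hlt.
  move=> lik ltk iS kS.
  have edge p : p.+1 < size c -> nth x0 c p \notin Q -> nth x0 c p.+1 \notin Q ->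
      adj_off [set x in c] Q (nth x0 c p) (nth x0 c p.+1).
    move=> ltp pQ p1Q; rewrite /adj_off !in_setD pQ p1Q !nthc ?adjE ?eqxx //; arith.
  have [iQ kQ] : nth x0 c i \notin Q /\ nth x0 c k \notin Q.
    by move: iS kS; rewrite !in_setD => /andP[-> _] /andP[-> _].
  have [/existsP[p /andP[/andP[ip pk] pQ]]|] :=
    boolP [exists p : 'I_(size c), (i < p < k) && (nth x0 c p \in Q)]; last first.
    rewrite negb_exists => /forallP noQ.
    have {}noQ p : i <= p <= k -> nth x0 c p \notin Q.
      have [->|pi] := eqVneq p i; first by [].
      have [->|pk] := eqVneq p k; first by [].
      move=> /andP[ip pk']; have ltp : p < size c by arith.
      by apply: contraNN (noQ (Ordinal ltp)) => /= ->; rewrite andbT; arith.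
    apply: connect_chain (ltnW lik) _ => p Hp; apply: edge; try apply: noQ; arith.
  (* A member of [Q] on the other arc would be adjacent to [p], although [i] and [k] separate the
     two on the cycle. *)
  have noQ q : q < size c -> (k <= q) || (q <= i) -> nth x0 c q \notin Q.
    move=> ltq out; apply/negP=> qQ.
    have [qi|qi] := eqVneq q i; first by rewrite -qi qQ in iQ.
    have [qk|qk] := eqVneq q k; first by rewrite -qk qQ in kQ.
    have ltp : p < size c by [].
    have := cQ _ _ pQ qQ; rewrite nth_uniq // adjE //; arith.
  rewrite (sym_connect_sym (@adj_off_sym _ _)).
  apply: (@connect_trans _ _ (nth x0 c (size c).-1)).
    apply: connect_chain => [|r Hr]; first arith.
    apply: edge; try apply: noQ; arith.
  apply: (@connect_trans _ _ (nth x0 c 0)).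
    have [l0 ll] : 0 < size c /\ (size c).-1 < size c by split; arith.
    apply: connect1; rewrite /adj_off !in_setD !nthc // adjE // !noQ //; arith.
  apply: connect_chain => [|r Hr]; first arith.
  apply: edge; try apply: noQ; arith.
Qed.

(** If [Q] contained both cliques, a vertex of [C'] would be adjacent to all of [C], against the
    maximality of [C]. *)
Lemma clique_not_sub (S C C' Q : {set V}) : S != set0 ->
  is_clique_in adj S C -> is_clique_in adj S C' ->
  [disjoint C & C'] -> complete Q -> C \subset Q -> exists2 z, z \in C' & z \notin Q.
Proof.
move=> S0 /and3P[_ _ /forallP Cmax] /and3P[C'S _ /forallP C'max] dCC' cQ CQ.
have [z zC'] : exists z, z \in C'.
  have [C'0|/set0Pn//] := eqVneq C' set0.
  have [v vS] := set0Pn _ S0; have := C'max v.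
  by rewrite C'0 !inE vS /= => /existsP[y]; rewrite inE.
exists z => //; apply/negP=> zQ; have := Cmax z.
have zC : z \notin C by rewrite (disjointFl dCC').
rewrite inE zC (subsetP C'S) //= => /existsP[y /andP[yC]].
by case/negP; apply: cQ (subsetP CQ y yC) _ => //; apply: contraNneq zC => ->.
Qed.

Lemma clique_neq0 (S C : {set V}) : S != set0 -> is_clique_in adj S C -> exists z, z \in C.
Proof.
move=> S0 /and3P[_ _ /forallP Cmax]; have [C0|/set0Pn//] := eqVneq C set0.
have [v vS] := set0Pn _ S0; have := Cmax v.
by rewrite C0 !inE vS /= => /existsP[y]; rewrite inE.
Qed.

(** Since [S0] off [Q] is connected, it suffices to lead each remaining vertex of the path to [S0],
    either down to [C] or up to [C']. *)
Lemma ear_robust (S0 C C' : {set V}) v1 q : robust S0 ->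
  is_clique_in adj S0 C -> is_clique_in adj S0 C' -> [disjoint C & C'] ->
  q != [::] -> uniq (v1 :: q) -> induces_path adj (v1 :: q) ->
  (forall x, x \in v1 :: q -> x \notin S0) ->
  (forall x y, x \in v1 :: q -> y \in S0 ->
     adj x y = ((x == v1) && (y \in C)) || ((x == last v1 q) && (y \in C'))) ->
  robust (S0 :|: [set x in v1 :: q]).
Proof.
move=> [[u0 [w0 [u0S w0S uw0 nadj0]]] conn0] Ccl C'cl dCC' q0 up ipath pS0 padj.
have S00 : S0 != set0 by apply/set0Pn; exists u0.
split; first by exists u0, w0; rewrite !inE u0S w0S.
clear u0 w0 u0S w0S uw0 nadj0.
set p := v1 :: q in up ipath pS0 padj *; set S := _ :|: _.
have p2 : 1 < size p by rewrite /p; case: (q) q0.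
have adjE i j : i < size p -> j < size p ->
    adj (nth v1 p i) (nth v1 p j) = (j == i.+1) || (i == j.+1).
  by move=> lti ltj; rewrite ipath ?mem_nth // !index_uniq.
have adjS0 i y : i < size p -> y \in S0 ->
    adj (nth v1 p i) y = ((i == 0) && (y \in C)) || ((i.+1 == size p) && (y \in C')).
  move=> lti yS0; rewrite padj ?mem_nth //.
  have -> : (nth v1 p i == v1) = (i == 0) by rewrite -{2}[v1]/(nth v1 p 0) nth_uniq.
  have -> : last v1 q = nth v1 p (size q) by rewrite -last_nth.
  by rewrite nth_uniq.
clear ipath padj; clearbody p.
have CS0 : C \subset S0 by case/and3P: Ccl.
have C'S0 : C' \subset S0 by case/and3P: C'cl.
have [c cC] := clique_neq0 S00 Ccl; have [c' c'C'] := clique_neq0 S00 C'cl.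
have cC' : c \in C' = false by rewrite (disjointFr dCC').
have c'C : c' \in C = false by rewrite (disjointFl dCC').
have [cS0 c'S0] := (subsetP CS0 c cC, subsetP C'S0 c' c'C').
have S0S y : y \in S0 -> y \in S by rewrite inE => ->.
have pS i : i < size p -> nth v1 p i \in S by move=> ?; rewrite in_setU in_set mem_nth ?orbT.
have npS0 i : i < size p -> nth v1 p i \notin S0 by move=> ?; rewrite pS0 ?mem_nth.
have pne i y : i < size p -> y \in S0 -> nth v1 p i != y.
  by move=> lti yS0; apply: contraNneq (npS0 i lti) => ->.
move=> Q cQ; have off_sym := sym_connect_sym (@adj_off_sym S Q).
  have base x y : x \in S0 :\: Q -> y \in S0 :\: Q -> connect (adj_off S Q) x y.
    move=> xS yS; apply: connect_sub (conn0 Q cQ x y xS yS) => u w.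
    rewrite /adj_off !in_setD => /and3P[/andP[uQ uS] /andP[wQ wS] uw].
    by apply: connect1; rewrite /adj_off !in_setD uQ wQ uw !S0S.
  have edge k : k.+1 < size p -> nth v1 p k \notin Q -> nth v1 p k.+1 \notin Q ->
      adj_off S Q (nth v1 p k) (nth v1 p k.+1).
    move=> ltk kQ k1Q; have ltk' := ltnW ltk.
    by rewrite /adj_off !in_setD kQ k1Q !pS // adjE // eqxx.
  have link i y : i < size p -> nth v1 p i \notin Q -> y \in S0 :\: Q ->
      adj (nth v1 p i) y -> adj_off S Q (nth v1 p i) y.
    move=> lti iQ; rewrite in_setD => /andP[yQ yS0] iy.
    by rewrite /adj_off !in_setD iQ yQ iy pS // S0S.
  have down i z : i < size p -> z \in C -> z \notin Q ->
      (forall j, j <= i -> nth v1 p j \notin Q) ->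
      exists2 z, z \in S0 :\: Q & connect (adj_off S Q) (nth v1 p i) z.
    move=> lti zC zQ iQ; have zS0 := subsetP CS0 z zC.
    have zSQ : z \in S0 :\: Q by rewrite in_setD zQ.
    exists z => //; apply: (@connect_trans _ _ (nth v1 p 0)).
      rewrite off_sym; apply: connect_chain => // j Hj; apply: edge; try apply: iQ; arith.
    by apply: connect1; apply: link; rewrite ?adjS0 ?zC ?iQ //; arith.
  have upward i z : i < size p -> z \in C' -> z \notin Q ->
      (forall j, i <= j < size p -> nth v1 p j \notin Q) ->
      exists2 z, z \in S0 :\: Q & connect (adj_off S Q) (nth v1 p i) z.
    move=> lti zC' zQ iQ; have zS0 := subsetP C'S0 z zC'.
    have zSQ : z \in S0 :\: Q by rewrite in_setD zQ.
    exists z => //; apply: (@connect_trans _ _ (nth v1 p (size p).-1)).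
      apply: connect_chain => [|j Hj]; first arith.
      apply: edge; try apply: iQ; arith.
    apply: connect1; apply: link; rewrite ?adjS0 ?zC' ?iQ ?andbT //; arith.
  have to_S0 x : x \in S :\: Q ->
      exists2 z, z \in S0 :\: Q & connect (adj_off S Q) x z.
    rewrite in_setD => /andP[xQ]; rewrite in_setU in_set => /orP[xS0|xp].
      by exists x; rewrite ?in_setD ?xQ.
    rewrite -(nth_index v1 xp) in xQ *; have : index x p < size p by rewrite index_mem.
    move: (index x p) xQ => i iQ lti.
    (* If [Q] contains [C], a path vertex in [Q] is adjacent to [c] and must be the first one; so
       the way up is free and leads to a vertex of [C'] off [Q]. *)
    have [CQ|/subsetPn[z zC zQ]] := boolP (C \subset Q).
      have [z zC' zQ] := clique_not_sub S00 Ccl C'cl dCC' cQ CQ.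
      apply: (upward i z) => // j Hj; apply/negP=> jQ.
      have [ji|ji] := eqVneq j i; first by rewrite -ji jQ in iQ.
      have ltj : j < size p by case/andP: Hj.
      have := cQ _ _ jQ (subsetP CQ c cC) (pne _ _ ltj cS0).
      rewrite adjS0 // cC' andbF orbF; arith.
    have [C'Q|/subsetPn[z' z'C' z'Q]] := boolP (C' \subset Q).
      apply: (down i z) => // j Hj; apply/negP=> jQ.
      have [ji|ji] := eqVneq j i; first by rewrite -ji jQ in iQ.
      have ltj : j < size p by arith.
      have := cQ _ _ jQ (subsetP C'Q c' c'C') (pne _ _ ltj c'S0).
      rewrite adjS0 // c'C andbF orFb; arith.
    (* Members of [Q] on the path are consecutive, so they cannot lie on both sides of position [i],
       which is off [Q]. *)
    have [/existsP[j /andP[ji jQ]]|] :=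
      boolP [exists j : 'I_(size p), (j < i) && (nth v1 p j \in Q)].
      apply: (upward i z') => // k Hk; apply/negP=> kQ.
      have [ki|ki] := eqVneq k i; first by rewrite -ki kQ in iQ.
      have ltj : j < size p by [].
      have ltk : k < size p by arith.
      have := cQ _ _ jQ kQ; rewrite nth_uniq // adjE //; arith.
    rewrite negb_exists => /forallP noQ; apply: (down i z) => // j Hj.
    have [->//|ji] := eqVneq j i.
    have ltj : j < size p by arith.
    by apply: contraNN (noQ (Ordinal ltj)) => /= ->; rewrite andbT; arith.
  move=> x y /to_S0[z zS xz] /to_S0[z' z'S yz'].
  apply: connect_trans xz _; apply: connect_trans (base z z' zS z'S) _.
  by rewrite off_sym.
Qed.

Lemma gate_robust S : is_gate adj S -> robust S.
Proof.
elim=> [c uc c4 icyc|S0 C C' v1 q _ rob]; first exact: cycle_robust.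
exact: ear_robust.
Qed.
End Gates.

(** * A gate forces a node of large degree *)

Section GateDegree.
Variables (V T : finType) (adj : rel V) (e : rel T) (a b : V -> T) (S : {set V}).
Hypotheses (adj_sym : symmetric adj) (etree : tree e) (rep : end_rep adj e a b).
Hypothesis robS : robust adj S.

Local Notation sepr := (sep e a b).

Let esym : symmetric e. Proof. by case: etree. Qed.

Lemma sep_complete s t : e s t -> complete adj [set v | sepr s t v].
Proof.
by case: rep => _ adjP _ est v w; rewrite !inE => sv sw vw; apply/adjP => //; exists s, t.
Qed.

Lemma sep_inside s t s' t' v : e s t -> e s' t' ->
  a v \in side e s t -> b v \in side e s t -> sepr s' t' v ->
  s' \in side e s t /\ t' \in side e s t.
Proof.
move=> est est' av bv sv; have [eq|ne] := eqVneq [set s'; t'] [set s; t].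
  have nsep : ~~ sepr s t v by rewrite /sep av bv.
  move/eqP: eq; rewrite eq_set2 => /orP[]/andP[/eqP es /eqP et]; subst.
    by rewrite sv in nsep.
  by rewrite (sepC _ _ etree) // sv in nsep.
have eq_in := edge_side etree est est' ne.
suff : s' \in side e s t by move=> s'in; rewrite -eq_in.
apply: contraTT sv => s'out; have t'out : t' \notin side e s t by rewrite -eq_in.
by rewrite /sep negbK (side_laminar etree est est' s'out t'out av bv).
Qed.

(** The orientation of the edge from [s] to [t]. A path avoiding the edge has both ends on one side,
    so testing [a v] is enough. *)
Definition big_side s t :=
  [forall v in S, ~~ sepr s t v ==> (a v \in side e s t)].

Lemma big_sideP s t v : big_side s t -> v \in S -> ~~ sepr s t v ->
  a v \in side e s t /\ b v \in side e s t.
Proof.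
move=> /forallP/(_ v)/implyP bst /bst/implyP avP nsv.
by have av := avP nsv; move: nsv; rewrite /sep negbK => /eqP <-.
Qed.

(** The paths through the edge form a complete set, so the others are connected within [S]. Adjacent
    ones share an edge, which cannot lie in both sides; hence all lie on the same side. *)
Lemma big_side_total s t : e s t -> big_side s t || big_side t s.
Proof.
move=> est; have ets : e t s by rewrite esym.
have [//|] := boolP (big_side s t).
rewrite negb_forall => /existsP[v]; rewrite negb_imply => /andP[vS].
rewrite negb_imply => /andP[nsv avn].
apply/forallP=> w; apply/implyP=> wS; apply/implyP; rewrite (sepC _ _ etree) // => nsw.
rewrite (sideC etree est) in_setC.
have [_ conn] := robS; have := conn _ (sep_complete est) v w.
rewrite !in_setD !in_set nsv nsw vS wS => /(_ isT isT) vw.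
apply: (connect_ind (Y := [pred u | a u \notin side e s t])) vw avn => u u'.
rewrite /adj_off !in_setD !in_set => /and3P[/andP[nsu uS] /andP[nsu' u'S] uu'] /= au.
have [<-//|une] := eqVneq u u'.
have [_ adjP _] := rep; have [s' [t' [est' su su']]] := (adjP u u' une).1 uu'.
apply/negP=> au'.
have bu' : b u' \in side e s t by move: nsu'; rewrite /sep negbK => /eqP <-.
have bu : b u \notin side e s t by move: nsu; rewrite /sep negbK => /eqP <-.
have [s'in _] := sep_inside est est' au' bu' su'.
have [] : s' \in side e t s /\ t' \in side e t s.
  by apply: sep_inside ets est' _ _ su; rewrite (sideC etree est) in_setC.
by rewrite (sideC etree est) in_setC s'in.
Qed.

(** As [S] is not complete, some path of [S] avoids the edge, and it lies on one side only. *)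
Lemma big_side_asym s t : e s t -> big_side s t -> ~~ big_side t s.
Proof.
move=> est bst; apply/negP=> bts.
have [[u [w [uS wS uw nuw]]] _] := robS.
have [v vS nsv] : exists2 v, v \in S & ~~ sepr s t v.
  have [su|] := boolP (sepr s t u); last by exists u.
  have [sw|] := boolP (sepr s t w); last by exists w.
  by rewrite (sep_complete est) ?inE in nuw.
have [av _] := big_sideP bst vS nsv.
rewrite -(sepC _ _ etree) // in nsv.
by have [] := big_sideP bts vS nsv; rewrite (sideC etree est) in_setC av.
Qed.

(** Otherwise every node has an outgoing oriented edge. Take one whose side is smallest: the next
    oriented edge does not turn back, so its side is strictly smaller. *)
Lemma sink_exists : exists x, forall y, e x y -> big_side y x.
Proof.
suff /existsP[x /forallP xP] : [exists x, forall y, e x y ==> big_side y x].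
  by exists x => y; apply/implyP.
apply: contraT; rewrite negb_exists => /forallP nosink.
have out x : exists2 y, e x y & big_side x y.
  have := nosink x; rewrite negb_forall => /existsP[y]; rewrite negb_imply => /andP[exy nb].
  by exists y => //; have := big_side_total exy; rewrite (negPf nb) orbF.
have [[u _] _] := robS; have [y0 ey0 by0] := out (a u).
pose P (p : T * T) := e p.1 p.2 && big_side p.1 p.2.
have P0 : P (a u, y0) by rewrite /P ey0.
case: (@arg_minnP _ (a u, y0) P (fun p => #|side e p.1 p.2|) P0) => -[s t] /andP[/= est bst] min.
have [y ety bty] := out t; have := min (t, y); rewrite /P ety bty => /(_ isT) /=.
have ets : e t s by rewrite esym.
have ys : y != s by apply: contraTneq bty => ->; apply: big_side_asym.
rewrite leqNgt => /negP[]; apply: proper_card; apply/properP; split; last first.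
  by exists t; [apply: side_in|apply: side_notin].
apply/subsetP=> z zy; apply: contraNT ys => zn.
have zs : z \in side e t s by rewrite (sideC etree est) in_setC.
by rewrite (side_disjoint etree ety ets zy zs).
Qed.

(** The two ends differ, so one of them lies beyond some edge [x y]; a path avoiding that edge would
    lie entirely on the side of [x]. *)
Lemma sink_star_ends x v : (forall y, e x y -> big_side y x) -> v \in S ->
  star_ends e a b x v != set0.
Proof.
move=> sink vS; have [ab _ _] := rep.
suff [y exy yv] : exists2 y, e x y & (a v \in side e x y) || (b v \in side e x y).
  apply/set0Pn; exists y; rewrite inE exy /=; apply: contraLR yv => nsep.
  rewrite -(sepC _ _ etree) // in nsep.
  have [] := big_sideP (sink y exy) vS nsep.
  by rewrite (sideC etree exy) !in_setC => /negPf-> /negPf->.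
have [ax|ax] := eqVneq (a v) x.
  have [y exy bv] : exists2 y, e x y & b v \in side e x y.
    by apply: side_cover => //; rewrite -ax eq_sym.
  by exists y; rewrite // bv orbT.
by have [y exy av] := side_cover etree ax; exists y; rewrite // av.
Qed.

Lemma num_cliques_le_degree : num_cliques adj S <= max_degree e.
Proof.
have [x sink] := sink_exists.
pose St y := [set v in S | y \in star_ends e a b x v].
apply: (@leq_trans #|[set St y | y in [set y | e x y]]|); last first.
  apply: leq_trans (leq_imset_card _ _) _.
  by rewrite max_degreeE; apply: (leq_bigmax (F := deg e)).
apply/subset_leq_card/subsetP=> K; rewrite inE => Kcl.
have S0 : S != set0 by have [[u [w [uS _ _ _]]] _] := robS; apply/set0Pn; exists u.
have [c cK] := clique_neq0 S0 Kcl.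
case/and3P: Kcl => /subsetP KS /forallP Kc /forallP Kmax.
have [_ _ helly] := rep; have [||s [t [est sK]]] := helly K.
- by apply/set0Pn; exists c.
- move=> v w vK wK vw; have := Kc v; rewrite vK => /forallP/(_ w).
  by rewrite wK vw.
(* The common edge given by the Helly property may be far from [x]; all paths of [K] use an edge at
   [x], so it is replaced by one there. *)
have [y exy yP] := star_ends_branch a b x etree est.
have KSt v : v \in K -> y \in star_ends e a b x v.
  by move=> vK; apply: yP (sK v vK); apply: sink_star_ends (KS v vK).
apply/imsetP; exists y; rewrite ?inE //; apply/setP=> v; rewrite inE.
apply/idP/andP=> [vK|[vS yv]]; first by rewrite KSt ?KS.
apply/negPn/negP=> vK; have := Kmax v; rewrite in_setD vK vS => /existsP[w /andP[wK]].
case/negP; apply: (sep_complete exy); rewrite ?inE.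
- by have [] := star_ends_sep yv.
- by have [] := star_ends_sep (KSt w wK).
- by apply: contraNneq vK => ->.
Qed.
End GateDegree.

Lemma gate_not_Helly_h22 (V : finType) (adj : rel V) h (S : {set V}) :
  symmetric adj -> is_gate adj S -> h < num_cliques adj S -> ~ Helly_h22 adj h.
Proof.
move=> adj_sym gS hk /Helly_h22_ends[T [e [a [b [_ te rep degh]]]]].
have := num_cliques_le_degree te rep (gate_robust adj_sym gS).
by rewrite degh leqNgt hk.
Qed.

(** * Gates in a 2-connected graph *)

Section Biconnected.
Variables (T V : finType) (D : {set T}) (E : V -> {set T}).
Hypothesis ED : forall v, E v \subset D.

Lemma set2_of (v : V) p q : #|E v| = 2 -> p \in E v -> q \in E v -> p != q ->
  E v = [set p; q].
Proof.
move=> v2 pv qv pq; apply/eqP; rewrite eq_sym eqEcard cards2 pq v2 leqnn andbT.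
by apply/subsetP=> z; rewrite !inE => /orP[]/eqP->.
Qed.

Lemma set2_other (v : V) p : #|E v| = 2 -> p \in E v ->
  exists2 q, p != q & E v = [set p; q].
Proof.
move=> /eqP/cards2P[x [y [xy ->]]]; rewrite !inE => /orP[]/eqP->.
  by exists y.
by exists x; rewrite 1?eq_sym // setUC.
Qed.

Definition joined (S : {set V}) u w := [exists v in S, E v == [set u; w]].

Lemma joinedP (S : {set V}) u w : reflect (exists2 v, v \in S & E v = [set u; w]) (joined S u w).
Proof.
apply: (iffP existsP) => [[v /andP[vS /eqP]]|[v vS Ev]]; first by exists v.
by exists v; rewrite vS Ev eqxx.
Qed.

Lemma joined_sym S : symmetric (joined S).
Proof. by move=> u w; rewrite /joined; apply: eq_existsb => v; rewrite setUC. Qed.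

Lemma joined_in S u w : joined S u w -> (u \in D) && (w \in D).
Proof.
by case/joinedP=> v _ Ev; have := ED v; rewrite Ev subUset !sub1set.
Qed.

Definition crossed S y (A : {set T}) := exists p q,
  [/\ joined S p q, p \in A, q \notin A, p != y & q != y].

Lemma crossedC S y A : crossed S y (~: A) -> crossed S y A.
Proof.
move=> [p [q [pq pA qA py qy]]]; exists q, p.
by rewrite joined_sym; move: pA qA; rewrite !inE negbK; split.
Qed.

Lemma biconnP (S : {set V}) : (forall v, v \in S -> #|E v| = 2) ->
  biconn D E S <->
  (forall y (A : {set T}) p q, y \in D -> p \in D -> q \in D -> p != y -> q != y ->
     p \in A -> q \notin A -> crossed S y A).
Proof.
move=> S2; split=> [/forallP biS y A p q yD pD qD py qy pA qA|H].
  have := biS y; rewrite yD => /forallP/(_ ((A :&: D) :\ y)).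
  have -> : [&& (A :&: D) :\ y \subset D :\ y, (A :&: D) :\ y != set0 &
      (A :&: D) :\ y != D :\ y].
    rewrite setSD ?subsetIr //=; apply/andP; split.
      by apply/set0Pn; exists p; rewrite !inE py pA.
    by apply/eqP=> /setP/(_ q); rewrite !inE qy qD (negPf qA).
  move=> /existsP[v /and3P[vS /set0Pn[p' +] /set0Pn[q' +]]].
  rewrite !inE => /and4P[p'v p'y p'A p'D] /andP[q'v /and3P[+ q'y q'D]].
  rewrite q'y q'D andbT /= => q'A; exists p', q'; split=> //.
  apply/joinedP; exists v => //; apply: set2_of; rewrite ?S2 //.
  by apply: contraNneq q'A => <-.
apply/forallP=> y; apply/implyP=> yD; apply/forallP=> A; apply/implyP.
case/and3P=> AD /set0Pn[p pA] AnD; have := subsetP AD p pA; rewrite !inE => /andP[py pD].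
have [q qD qA] : exists2 q, q \in D :\ y & q \notin A.
  by apply/subsetPn; apply: contraNN AnD => DA; rewrite eqEsubset AD.
move: qD; rewrite !inE => /andP[qy qD].
have [p' [q' [pq' p'A q'A p'y q'y]]] := H y A p q yD pD qD py qy pA qA.
have /andP[_ q'D] := joined_in pq'.
case/joinedP: pq' => v vS Ev; apply/existsP; exists v; rewrite vS Ev.
apply/and3P; split=> //; apply/set0Pn; [exists p'|exists q'].
  by rewrite !inE eqxx p'A.
by rewrite !inE eqxx orbT q'A q'y q'D.
Qed.

Variable S0 : {set V}.
Hypotheses (S02 : forall v, v \in S0 -> #|E v| = 2) (biS0 : biconn D E S0).
Hypothesis minS0 : forall v, v \in S0 -> ~~ biconn D E (S0 :\ v).
Hypothesis D4 : 3 < #|D|.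

(** Without [v0] some cut, after deletion of some [y], is uncrossed by minimality. The whole of [S0]
    crosses it, so [v0] is the only edge that does. *)
Lemma uncrossed_edge v0 a b : v0 \in S0 -> E v0 = [set a; b] ->
  exists y (A : {set T}), [/\ y \in D, y != a, y != b, a \in A & b \notin A] /\
    ~ crossed (S0 :\ v0) y A.
Proof.
move=> v0S Ev0; have S2 v : v \in S0 :\ v0 -> #|E v| = 2.
  by rewrite !inE => /andP[_ /S02].
have := minS0 v0S; rewrite negb_forall => /existsP[y].
rewrite negb_imply => /andP[yD]; rewrite negb_forall => /existsP[A].
rewrite negb_imply negb_exists => /andP[/and3P[AD /set0Pn[p pA] AnD] /forallP nocross].
have [q qD qA] : exists2 q, q \in D :\ y & q \notin A.
  by apply/subsetPn; apply: contraNN AnD => DA; rewrite eqEsubset AD.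
have {}nocross : ~ crossed (S0 :\ v0) y A.
  move=> [p' [q' [pq' p'A q'A p'y q'y]]]; have /andP[_ q'D] := joined_in pq'.
  case/joinedP: pq' => v vS Ev; have /negP := nocross v; apply; rewrite vS Ev.
  apply/and3P; split=> //; apply/set0Pn; [exists p'|exists q'].
    by rewrite !inE eqxx p'A.
  by rewrite !inE eqxx orbT q'A q'y q'D.
have /setD1P[py pD] := subsetP AD p pA; have /setD1P[qy qD'] := qD.
have [p' [q' [pq' p'A q'A p'y q'y]]] :=
  (biconnP S02).1 biS0 y A p q yD pD qD' py qy pA qA.
have /eqP : [set p'; q'] == [set a; b].
  case/joinedP: pq' => v vS Ev; have [eqv|nev] := eqVneq v v0.
    by rewrite -Ev eqv Ev0.
  case: nocross; exists p', q'; split=> //; apply/joinedP; exists v => //.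
  by rewrite !inE nev.
move/eqP; rewrite eq_set2 => /orP[]/andP[/eqP pE /eqP qE]; subst p' q'.
  by exists y, A; split=> //; split=> //; rewrite eq_sym.
(* Here the edge crosses from [b] to [a], so the two parts are exchanged. *)
exists y, (~: A); split; last by move/crossedC.
by rewrite !inE negbK; split=> //; rewrite eq_sym.
Qed.

(** A parallel edge would also cross the cut that [v] alone crosses. *)
Lemma edges_simple v w : v \in S0 -> w \in S0 -> E v = E w -> v = w.
Proof.
move=> vS wS Evw; apply/eqP; apply/negPn/negP=> vw.
have /eqP/cards2P[a [b [ab Ev]]] := S02 vS.
have [y [A [[yD ya yb aA bA] []]]] := uncrossed_edge vS Ev.
exists a, b; split; rewrite 1?eq_sym //; apply/joinedP; exists w; rewrite -?Evw //.
by rewrite !inE eq_sym vw.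
Qed.

(* An ear of U: a path d_0, ..., d_n of length n >= 2 whose edges c_i come from
   S0 and that meets U exactly in its two ends. *)
Definition is_ear (U : {set T}) (x0 : T) (v0 : V) (d : seq T) (c : seq V) : Prop :=
  [/\ size d = (size c).+1, 1 < size c, uniq d,
      forall i, i < size c ->
        nth v0 c i \in S0 /\ E (nth v0 c i) = [set nth x0 d i; nth x0 d i.+1] &
      forall i, i < size d -> (nth x0 d i \in U) = (i == 0) || (i == size c)].

(** Leave [U] by an edge [a w] and let [R] be the component of [w] outside [U]. After deletion of
    [a] some edge still leaves [R], and it ends at another vertex [b] of [U]; a simple path through
    [R] completes the ear. *)
Lemma ear_exists (U : {set T}) p q z : U \subset D -> p \in U -> q \in U -> p != q ->
  z \in D -> z \notin U -> exists x0 v0 d c, is_ear U x0 v0 d c.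
Proof.
move=> UD pU qU pq zD zU.
have /biconnP bi := biS0; have {}bi := bi S02.
have [pD qD] := (subsetP UD p pU, subsetP UD q qU).
have zp : z != p by apply: contraNneq zU => ->.
(* Deleting [p] forces [a != p], which keeps [p] available as a vertex outside [R] when [a] is
   deleted. *)
have [|a [w [aw aU wU ap wp]]] := bi p U q z pD qD zD _ zp qU zU.
  by rewrite eq_sym.
have /andP[aD wD] := joined_in aw.
have /joinedP[v0 _ _] := aw.
pose r u v := [&& joined S0 u v, u \notin U & v \notin U].
pose R := [set s | connect r w s].
have RU s : s \in R -> s \notin U.
  rewrite inE => ws; apply: (connect_ind (Y := [pred s | s \notin U])) ws wU.
  by move=> u u' /and3P[].
have pR : p \notin R by apply/negP=> /RU; rewrite pU.
have wa : w != a by apply: contraNneq wU => ->.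
have [||s [b [sb sR bR sa ba]]] := bi a R w p aD wD pD wa _ _ pR.
- by rewrite eq_sym.
- by rewrite inE connect0.
have sU := RU s sR.
have bU : b \in U.
  apply: contraNT bR => bU; move: sR; rewrite !inE => /connect_trans; apply.
  by apply: connect1; rewrite /r sb sU.
move: sR; rewrite inE => /connectP[l pth def_s].
case/shortenP: pth def_s => {}l pth ul _ def_s.
have lU t : t \in w :: l -> t \notin U.
  rewrite inE => /orP[/eqP-> //|]; elim: (l) (w) pth => //= y l' IH x.
  move=> /andP[/and3P[_ _ yU] pth]; rewrite inE => /orP[/eqP->//|]; exact: IH pth.
pose f u v := odflt v0 [pick v' in S0 | E v' == [set u; v]].
have fP u v : joined S0 u v -> f u v \in S0 /\ E (f u v) = [set u; v].
  rewrite /f; case: pickP => [v' /andP[v'S /eqP] //|none] /joinedP[v' v'S Ev'].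
  by have := none v'; rewrite v'S Ev' eqxx.
pose s' := rcons (w :: l) b.
have pthW : path (joined S0) a s'.
  rewrite /s' rcons_path /= aw -def_s sb andbT.
  by apply: sub_path pth => u v /and3P[].
exists a, v0, (a :: s'), (pairmap f a s').
rewrite /is_ear size_pairmap /s' size_rcons; split=> //.
- by rewrite /= size_rcons.
- rewrite cons_uniq rcons_uniq ul mem_rcons in_cons eq_sym (negPf ba) andbT orFb.
  apply/andP; split; last by apply: contraTN bU; apply: lU.
  by apply: contraTN aU; apply: lU.
- move=> i lti; rewrite (nth_pairmap a); last by rewrite size_rcons.
  by apply: fP; apply: (pathP a pthW); rewrite size_rcons.
- case=> [|i]; first by rewrite [nth _ _ _]/= aU.
  rewrite [size _]/= [nth _ _ _]/= size_rcons -rcons_cons !ltnS => lei.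
  rewrite eqSS [_ == 0]/= orFb nth_rcons; have [lt|gt|_] := ltngtP i (size (w :: l)).
  + by apply/negbTE/lU/mem_nth.
  + by rewrite leqNgt gt in lei.
  + by rewrite bU.
Qed.

Lemma index_crossing (x0 : T) d (A : {set T}) n : nth x0 d 0 \in A ->
  nth x0 d n \notin A ->
  exists2 i, i < n & (nth x0 d i \in A) && (nth x0 d i.+1 \notin A).
Proof.
move=> d0; elim: n => [|n IH]; first by rewrite d0.
have [dn dn1|dn _] := boolP (nth x0 d n \in A); first by exists n; rewrite ?dn.
by have [i lti ?] := IH dn; exists i => //; apply: ltnW.
Qed.

(* An edge joining the ends of an ear would be superfluous in S0. *)
Lemma ear_no_chord U x0 v0 d c v1 :
  is_ear U x0 v0 d c -> v1 \in S0 ->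
  E v1 = [set nth x0 d 0; nth x0 d (size c)] ->
  (forall y (A : {set T}), y \notin U -> nth x0 d 0 \in A -> nth x0 d (size c) \notin A ->
     crossed (S0 :\ v1) y A) -> False.
Proof.
move=> [sd c2 ud cE dU] v1S Ev1 crossU.
have [y [A [[yD ya yb aA bA] nocross]]] := uncrossed_edge v1S Ev1; case: nocross.
(* If [y] is off the ear, the ear itself crosses the cut, by an edge other than [v1] since its
   length is at least 2. Otherwise [y] is an inner vertex of the ear, hence outside [U]. *)
have [yd|yd] := boolP (y \in d); last first.
  have [i lti /andP[diA di1A]] := index_crossing aA bA.
  have [ciS ciE] := cE i lti.
  exists (nth x0 d i), (nth x0 d i.+1); split=> //.
  - apply/joinedP; exists (nth v0 c i) => //; rewrite !inE ciS andbT.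
    apply: contraTneq isT => ci_v1; move: ciE; rewrite ci_v1 Ev1 => /eqP.
    rewrite eq_set2 !nth_uniq ?sd //; arith.
  - by apply: contraNneq yd => <-; rewrite mem_nth ?sd // ltnS ltnW.
  - by apply: contraNneq yd => <-; rewrite mem_nth ?sd.
have lti : index y d < size d by rewrite index_mem.
apply: crossU aA bA; rewrite -(nth_index x0 yd) dU // negb_or.
apply/andP; split; [apply: contraNneq ya|apply: contraNneq yb] => <-;
  by rewrite nth_index.
Qed.

(** A fourth vertex of [D] yields an ear of the triangle. The triangle edge joining the ends of the
    ear is a chord of it, and the two other triangle edges replace it in every cut at a vertex off
    the triangle. *)
Lemma triangle_free (p q r : T) : p != q -> q != r -> p != r ->
  joined S0 p q -> joined S0 q r -> ~~ joined S0 p r.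
Proof.
move=> pq qr pr jpq jqr; apply/negP=> jpr.
pose U := [set p; q; r].
have jU u w : u \in U -> w \in U -> u != w -> joined S0 u w.
  rewrite !inE -!orbA => /or3P[]/eqP-> /or3P[]/eqP->; rewrite ?eqxx //;
    by rewrite // joined_sym.
have U3 : #|U| = 3 by rewrite /U setUC cardsU1 cards2 !inE pq negb_or eq_sym pr eq_sym qr.
have /andP[pD qD] := joined_in jpq; have /andP[_ rD] := joined_in jqr.
have UD : U \subset D.
  by apply/subsetP=> t; rewrite !inE -orbA => /or3P[]/eqP->.
have [z zD zU] : exists2 z, z \in D & z \notin U.
  by apply/subsetPn; apply/negP=> /subset_leq_card; rewrite U3 leqNgt D4.
have [||x0 [v0 [d [c ear]]]] := ear_exists UD (p := p) (q := q) _ _ pq zD zU.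
- by rewrite !inE eqxx.
- by rewrite !inE eqxx orbT.
have [sd c2 ud cE dU] := ear.
set a := nth x0 d 0; set b := nth x0 d (size c).
have ab : a != b by rewrite nth_uniq ?sd //; arith.
have aU : a \in U by rewrite dU ?sd.
have bU : b \in U by rewrite dU ?sd // eqxx orbT.
have [t tU] : exists2 t, t \in U & t \notin [set a; b].
  by apply/subsetPn; apply/negP=> /subset_leq_card; rewrite U3 cards2 ab.
rewrite !inE negb_or => /andP[ta tb].
have /joinedP[v1 v1S Ev1] := jU a b aU bU ab.
apply: (ear_no_chord ear v1S Ev1) => y A yU aA bA.
have nU u : u \in U -> u != y by move=> uU; apply: contraNneq yU => <-.
have other u : joined S0 u t -> joined (S0 :\ v1) u t.
  case/joinedP=> v vS Ev; apply/joinedP; exists v => //; rewrite !inE vS andbT.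
  apply: contraTneq isT => v_v1; move: Ev; rewrite v_v1 Ev1 => /eqP.
  by rewrite eq_set2 ![_ == t]eq_sym (negPf ta) (negPf tb) !andbF.
have [tA|tA] := boolP (t \in A).
  exists t, b; split; rewrite ?nU // joined_sym; apply: other.
  by apply: jU; rewrite // eq_sym.
exists a, t; split; rewrite ?nU //; apply: other.
by apply: jU; rewrite // eq_sym.
Qed.

Lemma share_index (x0 : T) d v w i k j l : uniq d -> i < size d -> k < size d ->
  j < size d -> l < size d -> E v = [set nth x0 d i; nth x0 d k] ->
  E w = [set nth x0 d j; nth x0 d l] ->
  (E v :&: E w != set0) = [|| i == j, i == l, k == j | k == l].
Proof.
move=> ud lti ltk ltj ltl -> ->; apply/set0Pn/idP => [[z]|].
  rewrite !inE => /andP[/orP[]/eqP-> /orP[]]; rewrite nth_uniq // => ->;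
  by rewrite ?orbT.
case/or4P=> /eqP->; [exists (nth x0 d j)|exists (nth x0 d l)|exists (nth x0 d j)|
  exists (nth x0 d l)]; by rewrite !inE eqxx ?orbT.
Qed.

(** * Gates of the line graph and their cliques *)

Variable adj : rel V.
Hypotheses (adj_sym : symmetric adj) (adj_irr : irreflexive adj).
Hypothesis adjE : forall v w, v \in S0 -> w \in S0 -> v != w ->
  adj v w = (E v :&: E w != set0).

Definition support (S : {set V}) : {set T} := \bigcup_(v in S) E v.

Definition star (S : {set V}) u := [set v in S | u \in E v].

(* A gate of the line graph of (D, S0) whose cliques are the stars of its
   vertices. *)
Definition star_gate (S : {set V}) : Prop :=
  [/\ is_gate adj S, S \subset S0 &
      forall u, u \in support S ->
        exists v w, [/\ v \in star S u, w \in star S u & v != w]].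

Lemma in_support (S : {set V}) v u : v \in S -> u \in E v -> u \in support S.
Proof. by move=> vS uv; apply/bigcupP; exists v. Qed.

Lemma support_sub S : support S \subset D.
Proof. by apply/bigcupsP=> v _; apply: ED. Qed.

Lemma star_complete (S : {set V}) u v w : S \subset S0 -> v \in star S u -> w \in star S u ->
  v != w -> adj v w.
Proof.
move=> /subsetP SS; rewrite !inE => /andP[vS uv] /andP[wS uw] vw.
by rewrite adjE ?SS //; apply/set0Pn; exists u; rewrite inE uv.
Qed.

Lemma star_gate_neq0 S : star_gate S -> exists v, v \in S.
Proof.
by case=> /(gate_robust adj_sym)[[u [w [uS _ _ _]]] _] _ _; exists u.
Qed.

Lemma maximal_sub_star (S K : {set V}) u : S \subset S0 -> is_clique_in adj S K ->
  (forall v, v \in K -> u \in E v) -> K = star S u.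
Proof.
move=> SS /and3P[/subsetP KS _ /forallP Kmax] uK; apply/setP=> v.
apply/idP/idP=> [vK|vu]; first by rewrite inE KS ?uK.
apply/negPn/negP=> vK; have := Kmax v; rewrite in_setD vK /=.
have vS : v \in S by move: vu; rewrite inE => /andP[].
rewrite vS => /existsP[w /andP[wK]] /negP; apply; apply: (star_complete SS vu).
  by rewrite inE KS ?uK.
by apply: contraNneq vK => ->.
Qed.

(** For maximality: an edge that misses [u] and meets two edges of its star joins their other ends,
    which are distinct as there are no parallel edges; this closes a triangle. *)
Lemma star_clique S u : star_gate S -> u \in support S -> is_clique_in adj S (star S u).
Proof.
move=> [_ SS deg2] uU; have /subsetP sub := SS; apply/and3P; split.
- by apply/subsetP=> v; rewrite inE => /andP[].
- apply/forallP=> v; apply/implyP=> vu; apply/forallP=> w; apply/implyP=> wu.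
  by apply/implyP; apply: star_complete vu wu.
apply/forallP=> z; apply/implyP; rewrite in_setD inE => /andP[+ zS]; rewrite zS /= => uz.
have [v [w [vu wu vw]]] := deg2 u uU; apply: contraT.
rewrite negb_exists => /forallP nonadj.
have meets x : x \in star S u -> exists p, [/\ p \in E z, u != p & E x = [set u; p]].
  move=> xu; have := nonadj x; rewrite xu /= negbK.
  move: xu; rewrite inE => /andP[xS ux].
  have zx : z != x by apply: contraNneq uz => ->.
  have [p up Ex] := set2_other (S02 (sub _ xS)) ux.
  rewrite adjE ?sub // Ex => /set0Pn[p']; rewrite !inE => /andP[p'z /orP[]/eqP p'E].
    by rewrite p'E (negPf uz) in p'z.
  by exists p; rewrite -{1}p'E.
have [p [pz up Ev]] := meets v vu; have [q [qz uq Ew]] := meets w wu.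
have [vS wS] : v \in S0 /\ w \in S0.
  by move: vu wu; rewrite !inE => /andP[/sub-> _] /andP[/sub-> _].
have pq : p != q.
  by apply: contraNneq vw => pq; apply/eqP/edges_simple; rewrite // Ev Ew pq.
suff : ~~ joined S0 p q.
  by case/joinedP; exists z; rewrite ?sub //; apply: set2_of; rewrite ?S02 ?sub.
apply: (@triangle_free p u q); rewrite // 1?eq_sym //.
  by apply/joinedP; exists v; rewrite // Ev setUC.
by apply/joinedP; exists w.
Qed.

(** Pairwise meeting edges share a vertex or form a triangle, and triangles are excluded. *)
Lemma clique_star S K : star_gate S -> is_clique_in adj S K ->
  exists2 u, u \in support S & K = star S u.
Proof.
move=> gS Kcl; have [x xS] := star_gate_neq0 gS; have [_ SS _] := gS.
have Sn0 : S != set0 by apply/set0Pn; exists x.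
have /subsetP sub := SS.
have [v vK] := clique_neq0 Sn0 Kcl.
suff [u uv uK] : exists2 u, u \in E v & forall w, w \in K -> u \in E w.
  exists u; last exact: maximal_sub_star SS Kcl uK.
  by apply: in_support uv; case/and3P: Kcl => /subsetP/(_ v vK).
case/and3P: Kcl => /subsetP KS /forallP Kc _.
have Kmeet w z : w \in K -> z \in K -> exists2 p, p \in E w & p \in E z.
  move=> wK zK; have [<-|wz] := eqVneq w z.
    by have /eqP/cards2P[p [q [_ Ew]]] := S02 (sub _ (KS _ wK)); exists p; rewrite Ew !inE eqxx.
  have := Kc w; rewrite wK => /forallP/(_ z); rewrite zK wz /= adjE ?sub ?KS //.
  by case/set0Pn=> p; rewrite inE => /andP[]; exists p.
have card2 w : w \in K -> #|E w| = 2 by move=> /KS/sub/S02.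
have /eqP/cards2P[p [q [pq Ev]]] := card2 v vK.
have [/forallP allp|] := boolP [forall w in K, p \in E w].
  by exists p; rewrite ?Ev ?inE ?eqxx // => w wK; have := allp w; rewrite wK.
rewrite negb_forall => /existsP[w]; rewrite negb_imply => /andP[wK pw].
exists q; first by rewrite Ev !inE eqxx orbT.
move=> z zK; apply: contraT => qz.
have qw : q \in E w.
  have [p' ] := Kmeet v w vK wK; rewrite Ev !inE => /orP[]/eqP-> //.
  by rewrite (negPf pw).
have pz : p \in E z.
  have [p' ] := Kmeet v z vK zK; rewrite Ev !inE => /orP[]/eqP-> //.
  by rewrite (negPf qz).
have [r rw rz] := Kmeet w z wK zK.
have qr : q != r by apply: contraNneq qz => ->.
have pr : p != r by apply: contraNneq pw => ->.
suff : ~~ joined S0 p r.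
  by case/joinedP; exists z; rewrite ?sub ?KS //; apply: set2_of; rewrite ?card2.
apply: (@triangle_free p q r) => //; apply/joinedP.
  by exists v; rewrite ?sub ?KS.
by exists w; rewrite ?sub ?KS //; apply: set2_of; rewrite ?card2.
Qed.

Lemma num_cliques_star_gate S : star_gate S -> num_cliques adj S = #|support S|.
Proof.
move=> gS; have [_ /subsetP sub deg2] := gS.
rewrite /num_cliques -(@card_in_imset _ _ (star S) (support S)).
  congr #|pred_of_set _|; apply/setP=> K; rewrite inE; apply/idP/imsetP.
    by move=> Kcl; have [u uU ->] := clique_star gS Kcl; exists u.
  by case=> u uU ->; apply: star_clique.
(* Distinct vertices have distinct stars: two edges common to the stars of [u] and [w] would be
   parallel. *)
move=> u w uU wU eq_star; apply/eqP; apply: contraT => uw.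
have [v [v' [vu v'u vv']]] := deg2 u uU.
have [vw v'w] : v \in star S w /\ v' \in star S w by rewrite -eq_star.
move: vu v'u vw v'w; rewrite !inE => /andP[vS uv] /andP[v'S uv'] /andP[_ wv] /andP[_ wv'].
case/negP: vv'; apply/eqP/edges_simple; rewrite ?sub //.
by rewrite (set2_of (S02 (sub _ vS)) uv wv uw) (set2_of (S02 (sub _ v'S)) uv' wv' uw).
Qed.

(* Robustness for the one-vertex complete set {v0}: a gate is bridgeless. *)
Lemma star_gate_crossed (S : {set V}) v0 a b y (A : {set T}) :
  star_gate S -> v0 \in S -> E v0 = [set a; b] ->
  y \notin support S -> a \in A -> b \notin A -> crossed (S0 :\ v0) y A.
Proof.
move=> gS v0S Ev0 yU aA bA; have [gate /subsetP sub deg2] := gS.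
have other u : u \in support S -> exists2 v, v \in S :\ v0 & u \in E v.
  move=> /deg2[v [w [+ + vw]]]; rewrite !inE => /andP[vS uv] /andP[wS uw].
  have [vE|vn] := eqVneq v v0; last by exists v; rewrite // !inE vn.
  by exists w; rewrite // !inE -vE eq_sym vw.
have [v /setD1P[vn vS] av] : exists2 v, v \in S :\ v0 & a \in E v.
  by apply: other; apply: (in_support v0S); rewrite Ev0 !inE eqxx.
have [w /setD1P[wn wS] bw] : exists2 w, w \in S :\ v0 & b \in E w.
  by apply: other; apply: (in_support v0S); rewrite Ev0 !inE eqxx orbT.
have [/existsP[x /and3P[/setD1P[xn xS] /set0Pn[p +] /subsetPn[q qx qA]]]|] :=
  boolP [exists x in S :\ v0, (E x :&: A != set0) && ~~ (E x \subset A)].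
  rewrite inE => /andP[px pA]; exists p, q; split=> //.
  - apply/joinedP; exists x; first by rewrite !inE xn sub.
    by apply: set2_of; rewrite ?S02 ?sub //; apply: contraNneq qA => <-.
  - by apply: contraNneq yU => <-; apply: in_support px.
  - by apply: contraNneq yU => <-; apply: in_support qx.
rewrite negb_exists => /forallP nocross.
have {}nocross x : x \in S :\ v0 -> E x :&: A != set0 -> E x \subset A.
  by move=> xS xA; have := nocross x; rewrite xS xA negbK.
have [_ conn] := gate_robust adj_sym gate.
have vA : E v \subset A.
  by apply: nocross; [rewrite !inE vn|apply/set0Pn; exists a; rewrite inE av].
have vw : connect (adj_off adj S [set v0]) v w.
  apply: conn; rewrite ?inE ?vn ?wn // => x z; rewrite !inE => /eqP-> /eqP->.
  by rewrite eqxx.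
suff /subsetP/(_ b bw) : E w \subset A by rewrite (negPf bA).
apply: (connect_ind (Y := [pred x | E x \subset A])) vw vA => x z /= /and3P[xS zS xz] xA.
have [<- //|xz'] := eqVneq x z.
have /andP[_ xS'] : (x \notin [set v0]) && (x \in S) by rewrite -in_setD.
have /andP[_ zS'] : (z \notin [set v0]) && (z \in S) by rewrite -in_setD.
rewrite adjE ?sub // in xz; apply: nocross => //; case/set0Pn: xz => p.
rewrite inE => /andP[/(subsetP xA) pA pz]; apply/set0Pn; exists p.
by rewrite inE pz.
Qed.

Lemma ear_uniq U x0 v0 d c : is_ear U x0 v0 d c -> uniq c.
Proof.
move=> [sd c2 ud cE dU].
suff inj i j : i < size c -> j < size c -> nth v0 c i = nth v0 c j -> i = j.
  by apply/(uniqP v0) => i j; rewrite !inE; apply: inj.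
move=> lti ltj eq_c.
have [[_ Ei] [_ Ej]] := (cE i lti, cE j ltj); move: Ei; rewrite eq_c Ej => /eqP.
rewrite eq_set2 !nth_uniq ?sd //; arith.
Qed.

(** In the line graph the ear is a chordless path whose first edge is adjacent in [S] to the star of
    [a] only, and whose last to that of [b] only. The two stars are disjoint, as a common edge would
    be a chord of the ear. *)
Lemma ear_star_gate S x0 v0 d c : star_gate S -> is_ear (support S) x0 v0 d c ->
  star_gate (S :|: [set x in c]).
Proof.
move=> gS ear; have uc := ear_uniq ear; have [gate SS deg2] := gS.
have [sd c2 ud cE dU] := ear; have /subsetP sub := SS.
set U := support S in dU ear *.
pose a := nth x0 d 0; pose b := nth x0 d (size c).
have ab : a != b by rewrite nth_uniq ?sd //; arith.
have aU : a \in U by rewrite dU ?sd.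
have bU : b \in U by rewrite dU ?sd // eqxx orbT.
have cS x : x \in c -> x \in S0.
  by move=> xc; rewrite -(nth_index v0 xc); apply: (cE _ _).1; rewrite index_mem.
have nd : [disjoint star S a & star S b].
  rewrite -setI_eq0; apply/eqP/setP=> v; rewrite !inE; apply/negP.
  case/andP=> /andP[vS av] /andP[_ bv].
  have Ev := set2_of (S02 (sub _ vS)) av bv ab.
  apply: (ear_no_chord ear (sub _ vS) Ev) => y A yU aA bA.
  exact: (star_gate_crossed gS vS Ev yU aA bA).
have c_notin i : i < size c -> nth v0 c i \notin S.
  move=> lti; apply/negP=> ciS; have [_ Ei] := cE i lti.
  have : (nth x0 d i \in U) && (nth x0 d i.+1 \in U).
    by apply/andP; split; apply: (in_support ciS); rewrite Ei !inE eqxx ?orbT.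
  rewrite !dU ?sd //; arith.
have adjcc i j : i < size c -> j < size c ->
    adj (nth v0 c i) (nth v0 c j) = (j == i.+1) || (i == j.+1).
  move=> lti ltj; have [<-|ij] := eqVneq i j; first by rewrite adj_irr; arith.
  have [[iS Ei] [jS Ej]] := (cE i lti, cE j ltj).
  rewrite adjE ?nth_uniq // (share_index ud _ _ _ _ Ei Ej) ?sd //; arith.
have adjcS i y : i < size c -> y \in S ->
    adj (nth v0 c i) y = ((i == 0) && (y \in star S a)) ||
                         ((i.+1 == size c) && (y \in star S b)).
  move=> lti yS; have [iS Ei] := cE i lti.
  have iy : nth v0 c i != y by apply: contraNneq (c_notin i lti) => ->.
  rewrite (adjE iS (sub _ yS) iy) /star !in_set yS !andTb.
  have yU p : p \in E y -> p \in U by apply: in_support.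
  apply/set0Pn/orP => [[p]|[]/andP[/eqP iE py]].
  - rewrite inE Ei !inE => /andP[/orP[]/eqP-> py]; have := yU _ py.
      rewrite dU ?sd 1?ltnW // (ltn_eqF lti) orbF => i0; left.
      by rewrite i0 /a -(eqP i0).
    rewrite dU ?sd //= => iE; right; by rewrite iE /b -(eqP iE).
  - by exists a; rewrite inE py andbT Ei !inE iE eqxx.
  - by exists b; rewrite inE py andbT Ei !inE iE eqxx orbT.
split.
- have [v1 [q cq]] : exists v1 q, c = v1 :: q by case: (c) c2 => // v1 q; exists v1, q.
  have nth0c : nth v0 c 0 = v1 by rewrite cq.
  have nthlc : nth v0 c (size c).-1 = last v1 q by rewrite nth_last cq.
  have [l0 lc] : 0 < size c /\ (size c).-1 < size c by arith.
  have idx x : x \in c -> exists2 i, i < size c & x = nth v0 c i.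
    by move=> xc; exists (index x c); rewrite ?index_mem ?nth_index.
  rewrite cq; apply: (@gate_ext _ _ S (star S a) (star S b)); rewrite -?cq //.
  + exact: star_clique.
  + exact: star_clique.
  + by move: c2; rewrite cq; case: (q).
  + move=> x y xc yc; rewrite -{1}(nth_index v0 xc) -{1}(nth_index v0 yc).
    by rewrite adjcc ?index_mem.
  + by move=> x /idx[i lti ->]; apply: c_notin.
  + move=> x y /idx[i lti ->] yS; rewrite adjcS // -nthlc -nth0c !nth_uniq //.
    by congr (_ || (_ && _)); arith.
- by apply/subsetP=> x; rewrite !inE => /orP[/sub//|/cS].
- have starS u v : v \in star S u -> v \in star (S :|: [set x in c]) u.
    by rewrite !inE => /andP[-> ->].
  have oldu u : u \in U -> exists v w, [/\ v \in star (S :|: [set x in c]) u,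
      w \in star (S :|: [set x in c]) u & v != w].
    by move=> /deg2[v [w [vu wu vw]]]; exists v, w; rewrite !starS.
  move=> u /bigcupP[v]; rewrite !inE => /orP[vS uv|vc uv].
    exact/oldu/(in_support vS uv).
  have lti : index v c < size c by rewrite index_mem.
  have [k ltk uk] : exists2 k, k < size d & u = nth x0 d k.
    have [_] := cE _ lti; rewrite nth_index // => Ev; move: uv; rewrite Ev !inE.
    by case/orP=> /eqP->; [exists (index v c)|exists (index v c).+1]; rewrite // sd ltnS // ltnW.
  (* The ends of the ear are old vertices; an inner vertex [d_k] lies on the two edges [c_(k-1)] and
     [c_k]. *)
  have [k0|k0] := eqVneq k 0; first by apply: oldu; rewrite uk k0.
  have [kl|kl] := eqVneq k (size c); first by apply: oldu; rewrite uk kl.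
  have [ltk1 ltk2 kk] : [/\ k < size c, k.-1 < size c & k.-1.+1 = k].
    by rewrite sd in ltk; split; arith.
  have [[_ Ek] [_ Ek1]] := (cE k ltk1, cE _ ltk2).
  exists (nth v0 c k.-1), (nth v0 c k); rewrite nth_uniq //.
  have starc x : x \in c -> u \in E x -> x \in star (S :|: [set x in c]) u.
    by move=> xc ux; rewrite !inE xc ux orbT.
  split; last by arith.
    by apply: starc; rewrite ?mem_nth // Ek1 kk uk !inE eqxx orbT.
  by apply: starc; rewrite ?mem_nth // Ek uk !inE eqxx.
Qed.

Lemma ear_support S x0 v0 d c : is_ear (support S) x0 v0 d c ->
  #|support S| < #|support (S :|: [set x in c])|.
Proof.
move=> [sd c2 ud cE dU]; apply: proper_card; apply/properP; split.
  by apply/bigcupsP=> v vS; apply: (bigcup_sup v); rewrite inE vS.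
exists (nth x0 d 1); last by rewrite dU ?sd //; arith.
have lt0 : 0 < size c by arith.
have [_ E0] := cE 0 lt0; apply: (@in_support _ (nth v0 c 0)).
  by rewrite in_setU in_set mem_nth // orbT.
by rewrite E0 !inE eqxx orbT.
Qed.

(** Any edge [v1] of [S0], closed up by an ear of its two ends, gives the initial cycle. *)
Lemma star_gate_cycle : exists S, star_gate S.
Proof.
have [p pD] : exists p, p \in D by apply/card_gt0P; arith.
have [q qD] : exists q, q \in D :\ p.
  apply/card_gt0P; have := cardsD1 p D; rewrite pD; arith.
have [y yD] : exists y, y \in D :\ p :\ q.
  apply/card_gt0P; have := cardsD1 p D; have := cardsD1 q (D :\ p); rewrite pD qD; arith.
move: qD yD; rewrite !inE => /andP[qp qD] /and3P[yq yp yD].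
have [||||a [b [jab _ _ _ _]]] := (biconnP S02).1 biS0 y [set p] p q yD pD qD.
- by rewrite eq_sym.
- by rewrite eq_sym.
- by rewrite inE.
- by rewrite inE.
case/joinedP: jab => v1 v1S Ev1.
have ab : a != b by have := S02 v1S; rewrite Ev1 cards2; case: eqVneq.
have /andP[aD bD] : (a \in D) && (b \in D) by apply: (@joined_in S0); apply/joinedP; exists v1.
have [z zD zU] : exists2 z, z \in D & z \notin [set a; b].
  apply/subsetPn; apply/negP=> /subset_leq_card; rewrite cards2; arith.
have [|||x0 [v0 [d [c ear]]]] := @ear_exists [set a; b] a b z _ _ _ ab zD zU.
- by rewrite subUset !sub1set aD.
- by rewrite !inE eqxx.
- by rewrite !inE eqxx orbT.
have uc := ear_uniq ear; have [sd c2 ud cE dU] := ear.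
have Ev1d : E v1 = [set nth x0 d (size c); nth x0 d 0].
  apply: set2_of; rewrite ?S02 ?Ev1 ?dU ?sd ?eqxx ?orbT //.
  by rewrite nth_uniq ?sd //; arith.
(* The cyclic successor: with [v1] appended to [c], edge [i] joins [d_i] to [d_(nxt i)]. *)
pose nxt i := if i.+1 == size d then 0 else i.+1.
set c' := rcons c v1.
have sc' : size c' = size d by rewrite size_rcons sd.
have nxt_lt i : i < size d -> nxt i < size d by rewrite /nxt; case: ifPn; arith.
have c'E i : i < size d ->
    nth v0 c' i \in S0 /\ E (nth v0 c' i) = [set nth x0 d i; nth x0 d (nxt i)].
  move=> lti; rewrite nth_rcons /nxt sd eqSS; have [lt|gt|->] := ltngtP i (size c).
  - exact: cE.
  - arith.
  - by rewrite Ev1d.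
have d3 : 2 < size d by rewrite sd.
(* A cycle of length 3 would be a triangle of [S0]. *)
have d4 : 3 < size d.
  rewrite ltn_neqAle d3 andbT; apply/eqP=> d3'.
  have jn i : i < size d -> joined S0 (nth x0 d i) (nth x0 d (nxt i)).
    by move=> /c'E[ciS Ei]; apply/joinedP; exists (nth v0 c' i).
  have [j0 j1 j2] : [/\ joined S0 (nth x0 d 0) (nth x0 d 1),
    joined S0 (nth x0 d 1) (nth x0 d 2) & joined S0 (nth x0 d 2) (nth x0 d 0)].
    by have := (jn 0, jn 1, jn 2); rewrite /nxt -d3' /= => -[[-> // -> // -> //]].
  have : ~~ joined S0 (nth x0 d 0) (nth x0 d 2).
    by apply: (@triangle_free _ (nth x0 d 1)); rewrite ?nth_uniq -?d3'.
  by rewrite joined_sym j2.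
have uc' : uniq c'.
  suff inj i j : i < size d -> j < size d -> nth v0 c' i = nth v0 c' j -> i = j.
    by apply/(uniqP v0) => i j; rewrite !inE sc'; apply: inj.
  move=> lti ltj eq_c.
  have [[_ Ei] [_ Ej]] := (c'E i lti, c'E j ltj); move: Ei; rewrite eq_c Ej => /eqP.
  rewrite eq_set2 !nth_uniq ?nxt_lt // /nxt; do 2!case: ifPn; arith.
have adjc' i j : i < size d -> j < size d ->
    adj (nth v0 c' i) (nth v0 c' j) = (j == nxt i) || (i == nxt j).
  move=> lti ltj; have [<-|ij] := eqVneq i j.
    by rewrite adj_irr /nxt; case: ifPn; arith.
  have [[iS Ei] [jS Ej]] := (c'E i lti, c'E j ltj).
  rewrite adjE ?nth_uniq ?sc' // (share_index ud _ _ _ _ Ei Ej) ?nxt_lt //.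
  rewrite /nxt; do 2!case: ifPn; arith.
have idx x : x \in c' -> exists2 i, i < size d & x = nth v0 c' i.
  by move=> xc; exists (index x c'); rewrite -?sc' ?index_mem ?nth_index.
exists [set x in c']; split.
- apply: gate_cycle; rewrite ?sc' // => x w xc wc.
  rewrite !next_index // sc' -{1}(nth_index v0 xc) -{1}(nth_index v0 wc).
  have ltx : index x c' < size d by rewrite -sc' index_mem.
  have ltw : index w c' < size d by rewrite -sc' index_mem.
  rewrite adjc' //; have nxtE i : i < size d -> i.+1 %% size d = nxt i.
    move=> lti; rewrite /nxt; case: eqVneq => [->|ne]; first by rewrite modnn.
    by rewrite modn_small //; arith.
  by rewrite !nxtE.
- by apply/subsetP=> x; rewrite inE => /idx[i lti ->]; have [] := c'E i lti.
- move=> u /bigcupP[v]; rewrite inE => /idx[i lti ->] uv.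
  have starP (k l : nat) : k < size d -> (l == k) || (l == nxt k) -> nth x0 d l = u ->
      nth v0 c' k \in star [set x in c'] u.
    move=> ltk lk <-; have [_ Ek] := c'E k ltk.
    rewrite /star !in_set mem_nth ?sc' // Ek !in_set2.
    by case/orP: lk => /eqP->; rewrite eqxx ?orbT.
  have [k ltk /esym uk] : exists2 k, k < size d & u = nth x0 d k.
    have [_ Ei] := c'E i lti; move: uv; rewrite Ei !inE => /orP[]/eqP->.
      by exists i.
    by exists (nxt i); rewrite ?nxt_lt.
  pose prv := if k == 0 then (size d).-1 else k.-1.
  have ltp : prv < size d by rewrite /prv; case: ifPn; arith.
  exists (nth v0 c' k), (nth v0 c' prv); split.
  + by apply: (@starP k k); rewrite ?eqxx.
  + apply: (@starP prv k) => //; rewrite /prv /nxt; do 2!case: ifPn; arith.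
  + by rewrite nth_uniq ?sc' // /prv; case: ifPn; arith.
Qed.

Lemma star_gate_spanning : exists2 S, star_gate S & support S = D.
Proof.
have [S gS] := star_gate_cycle.
move: {2}(#|D| - #|support S|) (leqnn (#|D| - #|support S|)) => n.
elim: n S gS => [|n IH] S gS le_n.
  exists S => //; apply/eqP; rewrite eqEcard support_sub /=; arith.
have [DU|/subsetPn[z zD zU]] := boolP (D \subset support S).
  by exists S => //; apply/eqP; rewrite eqEsubset support_sub.
have [v vS] := star_gate_neq0 gS; have [_ /subsetP sub _] := gS.
have /eqP/cards2P[a [b [ab Ev]]] := S02 (sub _ vS).
have [||x0 [v0 [d [c ear]]]] :=
    @ear_exists (support S) a b z (support_sub S) _ _ ab zD zU.
- by apply: (in_support vS); rewrite Ev !inE eqxx.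
- by apply: (in_support vS); rewrite Ev !inE eqxx orbT.
apply: (IH (S :|: [set x in c])); first exact: ear_star_gate ear.
have := ear_support ear; have := subset_leq_card (support_sub (S :|: [set x in c])).
arith.
Qed.
End Biconnected.

(** * Passage from the host tree to the gate, and the equivalence *)

(** A set meeting both parts of a cut has at least two elements, so smaller ones can be discarded;
    the rest are genuine edges. *)
Lemma biconn_two_ends (T V : finType) (D : {set T}) (E : V -> {set T}) :
  (forall v, #|E v| <= 2) -> biconn D E setT -> biconn D E [set v | #|E v| == 2].
Proof.
move=> E2 /forallP bi; apply/forallP=> y; apply/implyP=> yD; apply/forallP=> A.
apply/implyP=> AP; have := bi y; rewrite yD => /forallP/(_ A); rewrite AP /=.
case/existsP=> v /and3P[_ vA vB]; apply/existsP; exists v; rewrite inE vA vB !andbT.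
rewrite eqn_leq E2 /=; case/set0Pn: vA => p; case/set0Pn: vB => q.
rewrite !inE => /andP[qv /andP[qA _]] /andP[pv pA].
have pq : p != q by apply: contraNneq qA => <-.
have <- : #|[set p; q]| = 2 by rewrite cards2 pq.
by apply/subset_leq_card/subsetP=> z; rewrite !inE => /orP[]/eqP->.
Qed.

Lemma gate_of_biconn (T V : finType) (adj : rel V) (e : rel T) (a b : V -> T) x :
  symmetric adj -> irreflexive adj -> tree e -> end_rep adj e a b -> 3 < deg e x ->
  biconn [set y | e x y] (star_ends e a b x) setT ->
  exists S : {set V}, is_gate adj S /\ num_cliques adj S = deg e x.
Proof.
move=> adj_sym adj_irr te rep degx bi.
pose E := star_ends e a b x; pose D := [set y | e x y].
have ED v : E v \subset D by apply/subsetP=> y; rewrite !inE => /andP[].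
have biX := biconn_two_ends (card_star_ends a b x te) bi.
have [S0 /minsetP[biS0 minS0] /subsetP sub] := minset_exists biX.
have S02 v : v \in S0 -> #|E v| = 2 by move=> /sub; rewrite inE => /eqP.
have minS0' v : v \in S0 -> ~~ biconn D E (S0 :\ v).
  move=> vS; apply/negP=> /minS0/(_ (subD1set _ _))/setP/(_ v).
  by rewrite !inE eqxx vS.
have adjE v w : v \in S0 -> w \in S0 -> v != w -> adj v w = (E v :&: E w != set0).
  move=> vS wS vw; apply: (adj_star_ends te rep) => //.
    by rewrite -card_gt0 S02.
  by rewrite -card_gt0 S02.
have [S gS suppS] := star_gate_spanning ED S02 biS0 minS0' degx adj_sym adj_irr adjE.
have gate : is_gate adj S by case: gS.
exists S; split=> //.
by rewrite (num_cliques_star_gate ED S02 biS0 minS0' degx adj_sym adjE gS) suppS.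
Qed.

Theorem theorem9 (V : finType) (adj : rel V)
  (adj_sym : symmetric adj) (adj_irr : irreflexive adj)
  (HG : Helly_EPT adj) (h : nat) (Hh : 3 <= h) :
  ~ Helly_h22 adj h <->
  exists k : nat, h < k /\
    exists S : {set V}, is_gate adj S /\ num_cliques adj S = k.
Proof.
split=> [notH|[k [hk [S [gS kS]]]]]; last first.
  by apply: gate_not_Helly_h22 adj_sym gS _; rewrite kS.
have [T [e [a [b [T0 te rep]]]]] := Helly_EPT_ends HG.
have hrep : has_rep adj e by split=> //; split=> //; exists a, b.
have [//|[T' [e' [a' [b' [x [te' rep' degx bi]]]]]]] := reduce_or_biconn Hh hrep.
exists (deg e' x); split=> //.
exact: gate_of_biconn adj_sym adj_irr te' rep' (leq_ltn_trans Hh degx) bi.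
Qed.
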